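(* Let $\Pi:R_\ell\to\mathrm{Hom}(\mathcal H)$ be a US-rep over $\mathfrak g$ at level $\ell$. For every $e^H\in T_{\ell,0}$, $$m_\Phi(e^H)=m_{\mathcal R_a}(e^H)=\sum_{e^{H'}\in T_{\mathcal R_a}}m_\Pi(e^{H+H'}).$$ If moreover $\Pi$ is a GUS-rep, then for every $e^H\in T_{\ell,0}$, $$m_{\Phi,0}(e^H)=m_{\mathcal R_a,0}(e^H)=\sum_{e^{H'}\in T_{\mathcal R_a}/T_{\mathcal R}}m_\Pi(e^{H+H'}).$$ In particular, if $\mathfrak g$ is a Lie algebra of type $ADE$, then $T_{\mathcal R}=T_{\mathcal R_a}$, and for a GUS-rep $\Pi$ one has $m_{\Phi,0}(e^H)=m_\Pi(e^H)$ for every $e^H\in T_{\ell,0}$.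
   Context: Lie theory. $\mathfrak g$ is a simple complex Lie algebra, the complexification of the Lie algebra of a simply connected compact Lie group $K$; $T\subset K$ is a maximal torus with Lie algebra $\mathfrak t$. Fix the invariant inner product $\langle\cdot,\cdot\rangle$, positive definite on $\mathfrak t$, and use it to regard roots and weights as elements of $\mathfrak t$; $r_+$ is the highest root, and the normalization is $\langle r_+,r_+\rangle=2$. Coroots are $H_r=2r/\langle r,r\rangle$. Elements of $T$ are written $e^H$, $H\in\mathfrak t$, where $e^{2\pi H}=1$ iff $H$ lies in the coroot lattice. $W$ is the Weyl group, acting on $\mathfrak t$ and on $T$ by $e^H\mapsto e^{\theta(H)}$; $\varepsilon(\theta)$ is the sign of $\theta\in W$; $\theta_r$ is the reflection in the root $r$. $\mathcal W$ is the weight lattice, $\mathcal R$ the root lattice, $Z(\mathfrak g)=\mathcal W/\mathcal R$. $\mathbf W_f$ is the set of fundamental weights, $\rho$ their sum. For a dominant weight $k$, $\chi_k$ is the character of the irreducible representation of $K$ with highest weight $k$, so $\chi_k(e^H)=\sum_s m_k(s)e^{i\langle s,H\rangle}$, the sum over the weights $s$ of the representation with multiplicities $m_k(s)$. Level. $\ell\in\mathbb N$, $n_c=c^\vee+\ell$ with $c^\vee$ the dual Coxeter number. $\mathcal R_a=\mathrm{span}_{\mathbb Z}\{\theta(r_+):\theta\in W\}\subset\mathcal R$, $\mathcal W_\ell=\mathcal W/n_c\mathcal R_a$. For a subgroup $A$ with $n_c\mathcal R_a\subset A\subset\mathcal W$ (equivalently a subgroup of $\mathcal W_\ell$), $T_A=\{e^{2\pi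 H}:H\in\mathfrak t,\ \langle r,H\rangle\in\mathbb Z\ \forall r\in A\}$; $T_\ell=T_{n_c\mathcal R_a}$. $T_{\ell,0}$ is the set of $e^H\in T_\ell$ with $e^{\theta_r(H)}\ne e^H$ for every root $r$. $\mathcal C_\ell$ is the set of $k=\sum_w k_w w\in\mathcal W$ ($w\in\mathbf W_f$) with all $k_w>0$ and $\langle k,H_{r_+}\rangle<n_c$. Verlinde ring. For $k\in\mathcal W_\ell$, $\tilde\chi_k$ is the function on $T_{\ell,0}$ given by $\tilde\chi_k(e^H)=\sum_{\theta\in W}\varepsilon(\theta)e^{i\langle\theta(k),H\rangle}$. $R_\ell$ is the fusion ring with $\mathbb Z$-basis $\{\tilde\chi_k\}_{k\in\mathcal C_\ell}$, multiplication $f\star g=fg/\tilde\chi_\rho$, identity $\tilde\chi_\rho$, and involution $\tilde\chi_k^*=\tilde\chi_{k^*}$, $k^*=\Omega(-k)$, where $\Omega\in W$ satisfies $\Omega(\rho)=-\rho$. Representations. A US-rep is a representation $\Pi:R_\ell\to\mathrm{Hom}(\mathcal H)$ on a finite-dimensional Hilbert space $\mathcal H$ with $\Pi(\tilde\chi_\rho)=I$ and $\langle\Pi(\tilde\chi_j)v,v'\rangle=\langle v,\Pi(\tilde\chi_j^* )v'\rangle$. It is a GUS-rep if in addition $\mathcal H=\bigoplus_{\kappa\in Z(\mathfrak g)}\mathcal H_\kappa$ is $Z(\mathfrak g)$-graded and $\Pi(\tilde\chi_j)\mathcal H_\kappa\subseteq\mathcal H_{\kappa+j-\rho}$. Write $\Pi_w=\Pi(\tilde\chi_{w+\rho})$,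 $w\in\mathbf W_f$. For $e^H\in T_\ell$, $m_\Pi(e^H)=\dim\{v\in\mathcal H:\Pi_wv=\chi_w(e^H)v\ \forall w\in\mathbf W_f\}$. Quantum root spaces. $L^2(\mathcal W_\ell)$ has basis of delta functions $\delta_k$, $k\in\mathcal W_\ell$. For $w\in\mathbf W_f$, $\Delta_w\delta_k=\sum_s m_w(s)\delta_{k+s}$ (sum over the weights $s$ of the irreducible representation of highest weight $w$). The full quantum root space is $\mathcal R_\Pi=\{f\in L^2(\mathcal W_\ell)\otimes\mathcal H:(\Delta_w\otimes I-I\otimes\Pi_w)f=0\ \forall w\in\mathbf W_f\}$; for a GUS-rep the quantum root space is $\mathcal R_{\Pi,0}=\mathcal R_\Pi\cap\bigoplus_{k\in\mathcal W_\ell}\mathbb C\delta_k\otimes\mathcal H_{-k}$. Translations: $\vartheta_j\delta_k=\delta_{k-j}$ on $L^2(\mathcal W_\ell)$ and $\tilde\vartheta_j=\vartheta_j\otimes I$, which preserves $\mathcal R_\Pi$ (and $\mathcal R_{\Pi,0}$ if $j\in\mathcal R$). Multiplicities. $m_A(e^H)=\dim\{f\in\mathcal R_\Pi:\tilde\vartheta_jf=e^{-i\langle j,H\rangle}f\ \forall j\in A\}$, and, for a GUS-rep and $A\subset\mathcal R$, $m_{A,0}(e^H)$ is the dimension of the same space with $\mathcal R_{\Pi,0}$ in place of $\mathcal R_\Pi$. The translations $\tilde\vartheta_r$ with $r\in\mathcal R_h=\{\theta(r_+):\theta\in W\}$ are the quantum Coxeter elements. The multiplicities of the quantum Coxeter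 exponent are $m_\Phi(e^H)=\dim\{f\in\mathcal R_\Pi:\tilde\vartheta_rf=e^{-i\langle r,H\rangle}f\ \forall r\in\mathcal R_h\}$ and, for a GUS-rep, $m_{\Phi,0}(e^H)=\dim\{f\in\mathcal R_{\Pi,0}:\tilde\vartheta_rf=e^{-i\langle r,H\rangle}f\ \forall r\in\mathcal R_h\}$. *)

(* Defs.v *)
From HB Require Import structures.
From mathcomp Require Import all_boot all_order all_algebra all_fingroup.
From mathcomp Require Import all_classical all_reals all_analysis.
From mathcomp Require Import sesquilinear complex generic_quotient ring_quotient.

Set Implicit Arguments.
Unset Strict Implicit.
Unset Printing Implicit Defensive.

Import Order.TTheory GRing.Theory Num.Theory.
Local Open Scope ring_scope.
Local Open Scope classical_set_scope.
Local Open Scope complex_scope.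

Section Linear.

(* The integral span of a set, as a membership predicate so that quotients by
   it can be formed. *)
Definition zspan (V : zmodType) (S : set V) : {pred V} := fun x =>
  `[< exists2 c : seq (int * V),
        (forall p, p \in c -> S p.2) & x = \sum_(p <- c) p.2 *~ p.1 >].

Fact zspan_zmod_closed (V : zmodType) (S : set V) : zmod_closed (zspan S).
Proof.
split; first by apply/asboolP; exists [::]; rewrite ?big_nil.
move=> x y /asboolP[cx Sx ->] /asboolP[cy Sy ->]; apply/asboolP.
exists (cx ++ [seq (- p.1, p.2) | p <- cy]).
  move=> p; rewrite mem_cat => /orP[/Sx//|/mapP[q /Sy Sq ->]//].
rewrite big_cat big_map/= -sumrN; congr (_ + _).
by apply: eq_bigr => p _; rewrite mulrNz.
Qed.

HB.instance Definition _ (V : zmodType) (S : set V) :=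
  GRing.isZmodClosed.Build V (zspan S) (zspan_zmod_closed S).

(* The dimension of a finite-dimensional subspace S of a possibly
   infinite-dimensional space: the length of a basis of S. *)
Definition sdim (F : fieldType) (V : lmodType F) (S : set V) : nat :=
  xget 0%N [set d : nat | exists b : 'I_d -> V,
    (forall c : 'I_d -> F, \sum_i c i *: b i = 0 -> forall i, c i = 0) /\
    (forall x, S x <-> exists c : 'I_d -> F, x = \sum_i c i *: b i)].

(* X meets every coset of the subgroup B contained in A exactly once. *)
Definition coset_reps (V : zmodType) (A B X : set V) : Prop :=
  X `<=` A /\ forall a, A a -> exists! x, X x /\ B (a - x).

End Linear.

Section Complexification.
Variables (R : realType) (V : vectType R).

(* (x, y) stands for x + i y. *)
Definition cplx : Type := (V * V)%type.

HB.instance Definition _ := GRing.Zmodule.on cplx.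

Definition cplx_scale (a : R[i]) (z : cplx) : cplx :=
  (complex.Re a *: z.1 - complex.Im a *: z.2,
   complex.Re a *: z.2 + complex.Im a *: z.1).

Fact cplx_scaleA a b z : cplx_scale a (cplx_scale b z) = cplx_scale (a * b) z.
Proof.
case: a b z => [a a'] [b b'] [x y]; rewrite /cplx_scale/=; congr (_, _).
  rewrite !scalerBr !scalerDr !scalerDl !scaleNr !scalerA !opprD.
  by rewrite -!addrA; congr (_ + _); rewrite [RHS]addrC addrA.
rewrite !scalerBr !scalerDr !scalerDl !scaleNr !scalerA.
by rewrite -!addrA; congr (_ + _); rewrite [RHS]addrC addrA.
Qed.

Fact cplx_scale1 : left_id 1 cplx_scale.
Proof.
by case=> x y; rewrite /cplx_scale/= !scale1r !scale0r subr0 addr0.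
Qed.

Fact cplx_scaleDr : right_distributive cplx_scale +%R.
Proof.
move=> a [x y] [x' y']; rewrite /cplx_scale/= !scalerDr opprD.
by congr (_, _); rewrite addrACA.
Qed.

Fact cplx_scaleDl z : {morph cplx_scale^~ z : a b / a + b}.
Proof.
case: z => x y [a a'] [b b']; rewrite /cplx_scale/= !scalerDl opprD.
by congr (_, _); rewrite addrACA.
Qed.

HB.instance Definition _ := GRing.Zmodule_isLmodule.Build R[i] cplx
  cplx_scaleA cplx_scale1 cplx_scaleDr cplx_scaleDl.

Definition cplx_bracket (br : V -> V -> V) (z z' : cplx) : cplx :=
  (br z.1 z'.1 - br z.2 z'.2, br z.1 z'.2 + br z.2 z'.1).

End Complexification.

Definition is_lie_bracket (F : fieldType) (g : lmodType F) (br : g -> g -> g) :=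
  [/\ forall a x y z, br (a *: x + y) z = a *: br x z + br y z,
      forall x, br x x = 0 &
      forall x y z, br x (br y z) + br y (br z x) + br z (br x y) = 0].

Definition is_ideal (F : fieldType) (g : lmodType F) (br : g -> g -> g)
    (I : set g) :=
  [/\ I 0, forall a x y, I x -> I y -> I (a *: x + y) &
      forall x y, I y -> I (br x y)].

Definition simple_lie (F : fieldType) (g : lmodType F) (br : g -> g -> g) :=
  [/\ is_lie_bracket br, exists x y, br x y <> 0 &
      forall I, is_ideal br I -> I = [set 0] \/ I = setT].

(* The compact group K enters through its Lie algebra [kalg], the maximal torus
   T of K through the Lie algebra [tor] of T; the simple roots fix a choice of
   Weyl chamber. *)
Record lie_data (R : realType) := LieData {
  kalg : vectType R;
  kbr : kalg -> kalg -> kalg;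
  kdot : {dot kalg for idfun};
  tor : {vspace kalg};
  rank : nat;
  sroot : rank.-tuple (subvs_of tor);
  hroot : subvs_of tor }.

Section LieTheory.
Variables (R : realType) (D : lie_data R).

Definition tt : vectType R := subvs_of (tor D).
Definition dot (x y : tt) : R := kdot D (vsval x) (vsval y).

(* The complex Lie algebra is the complexification of [kalg]; a root r : tt is
   a nonzero weight of its adjoint representation, [H, z] = i <r, H> z. *)
Definition gc : lmodType R[i] := cplx (kalg D).
Definition gbr : gc -> gc -> gc := cplx_bracket (@kbr R D).
Definition is_root (r : tt) : Prop :=
  r <> 0 /\ exists2 z : gc, z <> 0 &
    forall H : tt, gbr (vsval H, 0) z = (0 +i* dot r H) *: z.

Definition coroot (r : tt) : tt := (2 / dot r r) *: r.
Definition sr (i : 'I_(rank D)) : tt := tnth (sroot D) i.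
Definition rplus : tt := hroot D.

Definition nonneg (x : tt) : Prop :=
  exists c : 'I_(rank D) -> nat, x = \sum_i sr i *+ c i.

(* [kalg] is the Lie algebra of a compact group because of the invariant inner
   product; its complexification is simple. *)
Record simple_lie_data : Prop := SimpleLieData {
  kbr_lie : is_lie_bracket (@kbr R D);
  gbr_simple : simple_lie gbr;
  kdot_invariant : forall x y z, kdot D (kbr x y) z = kdot D x (kbr y z);
  tor_abelian : {in tor D &, forall x y, kbr x y = 0};
  tor_maximal : forall x, {in tor D, forall y, kbr x y = 0} -> x \in tor D;
  sroot_basis : basis_of fullv (sroot D);
  sroot_root : forall i, is_root (sr i);
  root_sign : forall r, is_root r -> nonneg r \/ nonneg (- r);
  rplus_root : is_root rplus;
  rplus_highest : forall r, is_root r -> nonneg (rplus - r);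
  rplus_norm : dot rplus rplus = 2 }.

Definition reflection (r : tt) : 'End(tt) :=
  linfun (fun H : tt => H - dot H (coroot r) *: r).

Inductive weyl : 'End(tt) -> Prop :=
| weyl_one : weyl \1%VF
| weyl_refl r theta : is_root r -> weyl theta ->
    weyl (reflection r \o theta)%VF.

(* The sign of theta is its determinant. *)
Definition wsgn (theta : 'End(tt)) : R[i] :=
  let e := vbasis (fullv : {vspace tt}) in (\det (passmx.mxof e e theta))%:C.

Definition fweight (i : 'I_(rank D)) : tt :=
  xget 0 [set w : tt | forall j, dot w (coroot (sr j)) = (i == j)%:R].

(* The weight lattice, spanned by the fundamental weights. *)
Definition weight : Type := {x : tt | x \in zspan (range fweight)}.
HB.instance Definition _ := SubChoice.on weight.
HB.instance Definition _ := [SubChoice_isSubZmodule of weight by <:].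

Fact fweight_in i : fweight i \in zspan (range fweight).
Proof.
apply/asboolP; exists [:: (1, fweight i)]; last by rewrite big_seq1.
by move=> p; rewrite inE => /eqP ->; exists i.
Qed.

Definition fw (i : 'I_(rank D)) : weight := exist _ (fweight i) (fweight_in i).
Definition rho : weight := \sum_i fw i.

(* Sublattices of the weight lattice given by generators in [tt]. *)
Definition sublattice (S : set tt) : {pred weight} :=
  fun x => val x \in zspan S.

Fact sublattice_zmod_closed S : zmod_closed (sublattice S).
Proof.
have E x : (x \in sublattice S) = (val x \in zspan S) by [].
split=> [|x y]; rewrite !E ?raddf0 ?raddfB; first exact: rpred0.
exact: rpredB.
Qed.

HB.instance Definition _ (S : set tt) :=
  GRing.isZmodClosed.Build weight (sublattice S) (sublattice_zmod_closed S).

Definition root_lattice : set tt := [set x | x \in zspan is_root].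
Definition Rh : set tt := [set r | exists2 theta, weyl theta & r = theta rplus].
Definition Ra : set tt := [set x | x \in zspan Rh].

Definition Zg : zmodType := Quotient.quot (sublattice is_root).
Definition clsZ (k : weight) : Zg := \pi_Zg%qT k.

(* T = tt / 2 pi (coroot lattice), written additively: [expT H] is e^H and the
   sum of two elements of [torus] is their product in T.  [logT u] is some H
   with e^H = u; e^{i<k, logT u>} does not depend on the choice for k in the
   weight lattice. *)
Definition torus : zmodType :=
  Quotient.quot (zspan [set (2 * trigo.pi) *: coroot r | r in is_root]).
Definition expT (H : tt) : torus := \pi_torus%qT H.
Definition logT (u : torus) : tt := repr u.

(* expi x = e^{ix} *)
Definition expi (x : R) : R[i] := cos x +i* sin x.

Definition TA (A : set tt) : set torus :=
  [set u | exists2 H : tt, (forall r, A r -> dot r H \is a Num.int) &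
                          u = expT ((2 * trigo.pi) *: H)].

(* Representations of the simply connected group K are those of its Lie
   algebra. *)
Section Rep.
Variables (V : vectType R[i]) (psi : kalg D -> 'End(V)).

Definition is_rep : Prop :=
  (forall a x y, psi (a *: x + y) = a%:C *: psi x + psi y) /\
  (forall x y, psi (kbr x y) = ((psi x \o psi y) - (psi y \o psi x))%VF).

Definition irreducible_rep : Prop :=
  [/\ is_rep, (fullv : {vspace V}) <> 0%VS &
      forall U : {vspace V}, (forall x, (psi x @: U <= U)%VS) ->
        U = 0%VS \/ U = fullv].

Definition weight_space (s : tt) : set V :=
  [set v | forall H : tt, psi (vsval H) v = (0 +i* dot s H) *: v].

Definition is_weight (s : tt) : Prop := exists2 v, v <> 0 & weight_space s v.

Definition highest_weight (k : tt) : Prop :=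
  is_weight k /\ forall s, is_weight s -> nonneg (k - s).

End Rep.

(* wmult k s is m_k(s).  The irreducible representation of highest weight k
   exists for dominant k and is unique up to isomorphism, so the set below is a
   singleton for dominant k. *)
Definition wmult (k : tt) : tt -> nat :=
  xget (fun=> 0%N) [set m : tt -> nat |
    exists (V : vectType R[i]) (psi : kalg D -> 'End(V)),
      [/\ irreducible_rep psi, highest_weight psi k &
          m = fun s => sdim (weight_space psi s)]].

Definition chi (w : weight) (u : torus) : R[i] :=
  \sum_(s \in [set: weight])
    (wmult (val w) (val s))%:R * expi (dot (val s) (logT u)).

Section Level.
Variable l : nat.

(* The dual Coxeter number is 1 + <rho, H_{r+}>. *)
Definition dual_coxeter : R := 1 + dot (val rho) (coroot rplus).
Definition nc : R := dual_coxeter + l%:R.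

Definition ncRh : set tt := [set nc *: r | r in Rh].
Definition ncRa : set tt := [set x | x \in zspan ncRh].

Definition Wl : zmodType := Quotient.quot (sublattice ncRh).
Definition clsW (k : weight) : Wl := \pi_Wl%qT k.

Definition Tl : set torus := TA ncRa.
Definition Tl0 : set torus :=
  [set u | Tl u /\ forall r, is_root r -> expT (reflection r (logT u)) <> u].

Definition Cl : set weight :=
  [set k | (exists2 c : 'I_(rank D) -> int, (forall i, 0 < c i) &
              k = \sum_i fw i *~ c i) /\
           dot (val k) (coroot rplus) < nc].

(* Functions on T_{l,0} are represented as functions on T extended by 0. *)
Definition chit (k : weight) : torus -> R[i] := fun u =>
  if u \in Tl0 then
    \sum_(theta \in weyl) wsgn theta * expi (dot (theta (val k)) (logT u))
  else 0.

Definition Rl : set (torus -> R[i]) := [set f | f \in zspan [set chit k | k in Cl]].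
Definition star (f g : torus -> R[i]) : torus -> R[i] :=
  fun u => f u * g u / chit rho u.

(* kdual k k' : k' = k^* *)
Definition kdual (k k' : weight) : Prop :=
  exists2 Omega, weyl Omega /\ Omega (val rho) = - val rho &
                 val k' = Omega (- val k).

Section Representation.
Variables (H : vectType R[i]) (ip : {dot H for Num.conj}).

(* A representation of R_l is given by a map on all functions, of which only
   the values on R_l matter. *)
Variable Pi : (torus -> R[i]) -> 'End(H).

Record US_rep : Prop := USRep {
  US_add : forall f g, Rl f -> Rl g -> Pi (f + g) = Pi f + Pi g;
  US_mul : forall f g, Rl f -> Rl g -> Pi (star f g) = (Pi f \o Pi g)%VF;
  US_one : Pi (chit rho) = \1%VF;
  US_adj : forall j j' v v', kdual j j' ->
    ip (Pi (chit j) v) v' = ip v (Pi (chit j') v') }.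

Variable gr : Zg -> {vspace H}.

(* H is the direct sum of the gr kappa. *)
Definition is_grading : Prop := forall v : H, exists! c : Zg -> H,
  [/\ finite_set [set kappa | c kappa <> 0],
      forall kappa, c kappa \in gr kappa &
      v = \sum_(kappa \in [set: Zg]) c kappa].

Record GUS_rep : Prop := GUSRep {
  GUS_US : US_rep;
  GUS_grading : is_grading;
  GUS_shift : forall (j : weight) kappa,
    (Pi (chit j) @: gr kappa <= gr (kappa + clsZ (j - rho)))%VS }.

Definition Piw (i : 'I_(rank D)) : 'End(H) := Pi (chit (fw i + rho)).

Definition m_Pi (u : torus) : nat :=
  sdim [set v : H | forall i, Piw i v = chi (fw i) u *: v].

(* L^2(W_l) (x) H is the space of functions W_l -> H, f standing for the sum of
   the delta_k (x) f k. *)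
Definition Delta (w : weight) (f : Wl -> H) : Wl -> H := fun k =>
  \sum_(s \in [set: weight]) (wmult (val w) (val s))%:R *: f (k - clsW s).

Definition translation (j : weight) (f : Wl -> H) : Wl -> H :=
  fun k => f (k + clsW j).

Definition root_space : set (Wl -> H) :=
  [set f | forall i, Delta (fw i) f = fun k => Piw i (f k)].

Definition root_space0 : set (Wl -> H) :=
  [set f | root_space f /\
           forall k : weight, f (clsW k) \in gr (clsZ (- k))].

Definition translation_mult (X : set (Wl -> H)) (A : set tt) (u : torus) : nat :=
  sdim [set f | X f /\ forall j : weight, A (val j) ->
    translation j f = expi (- dot (val j) (logT u)) *: f].

Definition m_A (A : set tt) : torus -> nat := translation_mult root_space A.
Definition m_A0 (A : set tt) : torus -> nat := translation_mult root_space0 A.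
Definition m_Phi : torus -> nat := translation_mult root_space Rh.
Definition m_Phi0 : torus -> nat := translation_mult root_space0 Rh.

End Representation.
End Level.

(* The Dynkin diagrams of types A, D, E on the nodes 0, ..., n-1.  In
   [dynkin_fork n b] the nodes 0, ..., n-2 form a path and the node n-1 is
   joined to b; b = n-3 gives D_n and b = 2 gives E_n. *)
Definition dynkin_path (i j : nat) : bool := (i.+1 == j) || (j.+1 == i).
Definition dynkin_fork (n b i j : nat) : bool :=
  if (i < n.-1)%N && (j < n.-1)%N then dynkin_path i j
  else ((i == n.-1) && (j == b)) || ((i == b) && (j == n.-1)).

Definition has_diagram (e : rel nat) : Prop :=
  exists s : {perm 'I_(rank D)}, forall i j : 'I_(rank D),
    dot (sr (s i)) (coroot (sr (s j))) =
      if i == j then 2 else if e i j then -1 else 0.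

Definition type_ADE : Prop :=
  [\/ has_diagram dynkin_path,
      (4 <= rank D)%N /\ has_diagram (dynkin_fork (rank D) (rank D - 3)) |
      rank D \in [:: 6; 7; 8]%N /\ has_diagram (dynkin_fork (rank D) 2)].

End LieTheory.

Arguments rplus {R} D.
Arguments root_lattice {R} D _.
Arguments Rh {R} D _.
Arguments Ra {R} D _.
Arguments rho {R} D.

(* Main.v *)
(* Expanding a function on W_l in characters, f(k) = sum_x e^{-i<k,x>} v_x with x
   in T_l, turns the equations of the root space into Pi_w v_x = chi_w(x) v_x and
   those of the translations by R_a into v_x = 0 unless x is in u T_{R_a}; hence
   the first formula.  In the graded case f(k) lies in H_{-k}, and this relates
   the coefficients at points differing by an element c of T_R: the component of
   degree -k of v_{x+c} is e^{i<k,c>} times that of v_x.  So f is determined by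
   coefficients v_x, with x running over representatives modulo T_R, and these
   are free in the eigenspaces of the Pi_w.

   For this R_a must have finite index in W and n_c must be a positive integer,
   which rest on the integrality of the root system: from a root vector x + i y
   one gets an sl_2-triple, since [x, y] = - |x|^2 r by invariance of the inner
   product.  In the types ADE all simple roots are conjugate, hence R_a = R. *)

Require Import Defs.
From HB Require Import structures.
From mathcomp Require Import all_boot all_order all_algebra all_fingroup.
From mathcomp Require Import all_classical all_reals all_analysis.
From mathcomp Require Import sesquilinear complex generic_quotient ring_quotient.
From mathcomp Require Import ring zify.

Set Implicit Arguments.
Unset Strict Implicit.
Unset Printing Implicit Defensive.

Import Order.TTheory GRing.Theory Num.Theory.
Local Open Scope ring_scope.
Local Open Scope classical_set_scope.
Local Open Scope complex_scope.

(** The dual group of [Wl] is never formed. Some N > 0 satisfies N W inside n_c R_a, so a function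
    on [Wl] expands over the N-torsion points of T, which have explicit coordinates in the simple
    coroots; the coefficients are unique because distinct points give distinct characters of W.
    There may be more such points than T_l contains, but the translation equations kill every
    coefficient outside u + T_{R_a}. In the graded case the expansion is not supported on chosen
    representatives: all coefficients in a coset of T_R have, up to a phase, the same component of
    degree -k. Keeping the coefficient at the representative and multiplying it by the number of
    nonzero ones in the coset recovers the function without any averaging. That the kept
    coefficients are determined is a statement about characters restricted to R, because the
    projections onto degrees do not change along R. *)

Lemma zspan_gen (V : zmodType) (S : set V) x : S x -> x \in zspan S.
Proof.
move=> Sx; apply/asboolP; exists [:: (1, x)]; last by rewrite big_seq1.
by move=> p; rewrite inE => /eqP ->.
Qed.

Lemma zspan_ind (V : zmodType) (S P : set V) :
  P 0 -> (forall x y, P x -> P y -> P (x - y)) -> S `<=` P ->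
  forall x, x \in zspan S -> P x.
Proof.
move=> P0 PB SP x /asboolP[c Sc ->].
have PN y : P y -> P (- y) by rewrite -sub0r; exact: PB.
have PD y z : P y -> P z -> P (y + z).
  by move=> Py Pz; rewrite -[z]opprK; apply: PB => //; exact: PN.
have PM n y : P y -> P (y *+ n).
  by move=> Py; elim: n => [|n IH]; rewrite ?mulr0n// mulrS; exact: PD.
rewrite big_seq; apply: big_ind => // p pc.
have Py := SP _ (Sc _ pc).
by case: (p.1) => n; [exact: PM|rewrite NegzE mulrNz; exact/PN/PM].
Qed.

Lemma linear_map0 (F : fieldType) (U V : lmodType F) (T : U -> V) :
  linear T -> T 0 = 0.
Proof.
move=> Tl; have := Tl 1 0 0; rewrite !scale1r addr0 => /esym/eqP.
by rewrite -subr_eq0 addrK => /eqP.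
Qed.

(** * Dimensions of subspaces through bases *)

Section Sdim.
Variables (F : fieldType) (V : lmodType F).
Implicit Type S : set V.

(** The basis condition inside [sdim], but with any finite index type, so that bases of several
    spaces can be glued along a sigma type. *)
Definition sbasis (J : finType) S (b : J -> V) : Prop :=
  (forall c : J -> F, \sum_i c i *: b i = 0 -> forall i, c i = 0) /\
  (forall x, S x <-> exists c : J -> F, x = \sum_i c i *: b i).

(** The ambient space may have infinite dimension, so the comparison uses the transition matrices
    between the two bases: their product is the identity of size [d] and factors through size
    [d']. *)
Lemma sbasis_le S d d' (b : 'I_d -> V) (b' : 'I_d' -> V) :
  sbasis S b -> sbasis S b' -> (d <= d')%N.
Proof.
move=> [fb sb] [fb' sb'].
have mem i : S (b i).
  apply/sb; exists (fun j => (i == j)%:R).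
  rewrite (bigD1 i)//= eqxx scale1r big1 ?addr0// => j /negPf ji.
  by rewrite eq_sym ji scale0r.
have mem' i : S (b' i).
  apply/sb'; exists (fun j => (i == j)%:R).
  rewrite (bigD1 i)//= eqxx scale1r big1 ?addr0// => j /negPf ji.
  by rewrite eq_sym ji scale0r.
have /choice[A EA] : forall i, exists c : 'I_d' -> F, b i = \sum_j c j *: b' j.
  by move=> i; apply/sb'.
have /choice[B EB] : forall i, exists c : 'I_d -> F, b' i = \sum_j c j *: b j.
  by move=> i; apply/sb.
apply: (@mulmx1_min F _ _ (\matrix_(i, j) A i j) (\matrix_(i, j) B i j)).
apply/matrixP => i k; rewrite !mxE.
have := fb (fun k => \sum_j A i j * B j k - (i == k)%:R).
move=> /(_ _ k) AB; apply/eqP; rewrite -subr_eq0; apply/eqP.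
under eq_bigr do rewrite !mxE.
apply: AB => {k}.
transitivity (\sum_j A i j *: b' j - b i); last by rewrite EA subrr.
under eq_bigr do rewrite scalerBl; rewrite sumrB; congr (_ - _).
  under [RHS]eq_bigr do rewrite EB scaler_sumr.
  rewrite exchange_big; apply: eq_bigr => k _ /=; rewrite scaler_suml.
  by apply: eq_bigr => j _; rewrite scalerA.
rewrite (bigD1 i)//= eqxx scale1r big1 ?addr0// => j /negPf ji.
by rewrite eq_sym ji scale0r.
Qed.

Lemma sbasis_ord (J : finType) S (b : J -> V) :
  sbasis S b -> sbasis S (b \o @enum_val J predT).
Proof.
move=> [fb sb]; split=> [c c0 i|x].
  rewrite -(enum_valK i); apply: (fb (c \o enum_rank)).
  apply: etrans c0; rewrite (reindex _ (onW_bij _ (@enum_val_bij J)))/=.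
  by apply: eq_bigr => j _ /=; rewrite enum_valK.
split=> [/sb[c ->]|[c ->]].
  exists (c \o @enum_val J predT).
  by rewrite (reindex _ (onW_bij _ (@enum_val_bij J))).
apply/sb; exists (c \o enum_rank).
rewrite [RHS](reindex _ (onW_bij _ (@enum_val_bij J))).
by apply: eq_bigr => j _ /=; rewrite enum_valK.
Qed.

Lemma sdimE (J : finType) S (b : J -> V) : sbasis S b -> sdim S = #|J|.
Proof.
move=> /sbasis_ord Sb; apply: xget_subset1; first by exists (b \o @enum_val J predT).
move=> d d' [b1 Sb1] [b2 Sb2]; apply/eqP; rewrite eqn_leq.
by rewrite (sbasis_le Sb1 Sb2) (sbasis_le Sb2 Sb1).
Qed.

Lemma sdim_set0 : sdim [set 0 : V] = 0%N.
Proof.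
rewrite (@sdimE 'I_0 _ (fun=> 0)) ?card_ord//; split=> [c _ []//|x].
by split=> [->|[c ->]]; [exists (fun=> 0)|]; rewrite big_ord0.
Qed.

End Sdim.

Lemma sbasis_vspace (F : fieldType) (V : vectType F) (U : {vspace V}) :
  sbasis [set v | v \in U] (fun i : 'I_(\dim U) => (vbasis U)`_i).
Proof.
split=> [|x]; first by apply/freeP; exact: basis_free (vbasisP U).
split=> [xU|[c ->]].
  by exists (coord (vbasis U) ^~ x); exact: coord_vbasis.
by apply: rpred_sum => i _; apply: rpredZ; rewrite vbasis_mem ?mem_nth ?size_tuple.
Qed.

Lemma sdim_vspace (F : fieldType) (V : vectType F) (U : {vspace V}) :
  sdim [set v | v \in U] = \dim U.
Proof. by rewrite (sdimE (sbasis_vspace U)) card_ord. Qed.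

(** The second hypothesis packs the injectivity of each [Phi j] on [E j] together with the
    independence of the images, so the images of bases of the [E j] form one basis of [S]. *)
Lemma sdim_linear_image (F : fieldType) (V : lmodType F) (H : vectType F)
    (J : finType) (E : J -> {vspace H}) (Phi : J -> H -> V) (S : set V) :
  (forall j, linear (Phi j)) ->
  (forall v, (forall j, v j \in E j) -> \sum_j Phi j (v j) = 0 -> forall j, v j = 0) ->
  (forall f, S f <-> exists2 v, (forall j, v j \in E j) & f = \sum_j Phi j (v j)) ->
  sdim S = (\sum_j \dim (E j))%N.
Proof.
move=> Phil Phi0 SE.
pose K := {j : J & 'I_(\dim (E j))}.
pose b (k : K) : V := Phi (tag k) (vbasis (E (tag k)))`_(tagged k).
have PhiD j : {morph Phi j : x y / x + y}.
  by move=> x y; rewrite -[x]scale1r Phil !scale1r.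
have Phi00 j : Phi j 0 = 0 by exact: linear_map0.
have PhiZ j a x : Phi j (a *: x) = a *: Phi j x.
  by rewrite -[a *: x]addr0 Phil Phi00 addr0.
have bE (c : K -> F) : \sum_k c k *: b k =
    \sum_j Phi j (\sum_(i < \dim (E j)) c (Tagged _ i) *: (vbasis (E j))`_i).
  pose G j (i : 'I_(\dim (E j))) := c (Tagged _ i) *: Phi j (vbasis (E j))`_i.
  transitivity (\sum_(k : K | true && true) G (tag k) (tagged k)).
    by apply: eq_bigr => -[j i] _.
  rewrite -(@sig_big_dep _ _ _ _ _ xpredT (fun _ => xpredT)).
  apply: eq_bigr => j _.
  rewrite (big_morph (Phi j) (PhiD j) (Phi00 j)).
  by apply: eq_bigr => i _; rewrite PhiZ.
have Eb (v : J -> H) : (forall j, v j \in E j) ->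
    forall j, v j =
      \sum_(i < \dim (E j)) coord (vbasis (E j)) i (v j) *: (vbasis (E j))`_i.
  by move=> vE j; exact: coord_vbasis.
rewrite (@sdimE _ _ K _ b).
  rewrite card_tagged sumnE big_map big_enum/=.
  by apply: eq_bigr => j _; rewrite card_ord.
split=> [c|f].
  rewrite bE => /Phi0 c0 [j i].
  have H0 : \sum_(i < \dim (E j)) c (Tagged _ i) *: (vbasis (E j))`_i = 0.
    apply: (c0 _ j) => k; apply: rpred_sum => m _; apply: rpredZ.
    by rewrite vbasis_mem ?mem_nth ?size_tuple.
  have /freeP fE := basis_free (vbasisP (E j)).
  exact: (fE (fun i => c (Tagged _ i)) H0 i).
split=> [/SE[v vE ->]|[c ->]].
  exists (fun k => coord (vbasis (E (tag k))) (tagged k) (v (tag k))).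
  rewrite bE/=; apply: eq_bigr => j _; congr (Phi j _); exact: Eb.
apply/SE; eexists; last exact: bE.
move=> j /=; apply: rpred_sum => m _; apply: rpredZ.
by rewrite vbasis_mem ?mem_nth ?size_tuple.
Qed.

(** * Independence of characters and the abstract count *)

Lemma joint_eigenvectors_free (F : fieldType) (V : lmodType F) (I : Type)
    (T : I -> V -> V) (J : finType) (lam : J -> I -> F) :
  (forall i, linear (T i)) ->
  forall v : J -> V, (forall i j, T i (v j) = lam j i *: v j) ->
  (forall a b, a != b -> v a != 0 -> v b != 0 -> exists i, lam a i != lam b i) ->
  \sum_j v j = 0 -> forall j, v j = 0.
Proof.
move=> Tl v; have [n] := ubnP #|[set j | v j != 0]%SET|.
elim: n v => // n IH v vn Tv sep v0.
have T0 i : T i 0 = 0 by exact: linear_map0.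
have TD i : {morph T i : x y / x + y >-> x + y}.
  by move=> x y; rewrite -[x]scale1r Tl !scale1r.
have TZ i c x : T i (c *: x) = c *: T i x by rewrite -[c *: x]addr0 Tl T0 addr0.
have main a : v a != 0 -> forall b, b != a -> v b = 0.
  move=> va b ba; have [//|vb] := eqVneq (v b) 0; exfalso; apply/negP: (vb).
  have [i lab] := sep _ _ ba vb va; apply/negPn.
  (* Applying [T i - lam a i] to the relation removes the term [a] and only rescales the others, so
     the induction hypothesis covers the new relation; the factor at [b] is nonzero. *)
  suff /(_ b)/eqP : forall j, (lam j i - lam a i) *: v j = 0.
    by rewrite scaler_eq0 subr_eq0 (negPf lab).
  apply: IH => [|k j|c d cd|].
  - rewrite -ltnS; apply: leq_trans vn; rewrite ltnS; apply: proper_card.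
    apply/properP; split; last first.
      by exists a; rewrite !inE ?va// subrr scale0r eqxx.
    apply/fintype.subsetP => j; rewrite !inE; apply: contraNN => /eqP ->.
    by rewrite scaler0.
  - by rewrite TZ Tv scalerA mulrC -scalerA.
  - rewrite !scaler_eq0 !negb_or => /andP[_ vc] /andP[_ vd]; exact: sep.
  - under eq_bigr do rewrite scalerBl.
    rewrite sumrB -scaler_sumr v0 scaler0 subr0.
    by under eq_bigr do rewrite -Tv; rewrite -(big_morph _ (TD i) (T0 i)) v0 T0.
move=> a; apply/eqP; apply/negPn/negP => va; move: (va).
move: v0; rewrite (bigD1 a)//= big1; last by move=> b; exact: main.
by rewrite addr0 => ->; rewrite eqxx.
Qed.

(** The functions [chi j x *: v j] of x in M are joint eigenvectors of the translations by M.
    Separation is asked only between indices with nonzero vectors, because only for these is the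
    position of the corresponding point known later. *)
Lemma characters_free (F : fieldType) (V : lmodType F) (G : zmodType) (M : set G)
    (J : finType) (chi : J -> G -> F) (v : J -> V) :
  M 0 -> (forall x y, M x -> M y -> M (x + y)) ->
  (forall j x y, M x -> M y -> chi j (x + y) = chi j x * chi j y) ->
  (forall j, chi j 0 = 1) ->
  (forall a b, a != b -> v a != 0 -> v b != 0 ->
    exists2 x, M x & chi a x != chi b x) ->
  (forall x, M x -> \sum_j chi j x *: v j = 0) -> forall j, v j = 0.
Proof.
move=> M0 MD chiD chi0 sep v0 j.
pose S := {x | M x}.
pose add (x y : S) : S := exist _ _ (MD _ _ (svalP x) (svalP y)).
pose T (y : S) (f : S -> V) := fun x => f (add x y).
pose w j : S -> V := fun x => chi j (sval x) *: v j.
have wE k : w k != 0 -> v k != 0.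
  by apply: contraNN => /eqP vk; apply/eqP/funext => x; rewrite /w vk scaler0.
suff : w j = 0 by move/(congr1 (@^~ (exist _ 0 M0))); rewrite /w/= chi0 scale1r.
apply: (@joint_eigenvectors_free F _ S T J (fun j y => chi j (sval y)) _ w).
- by move=> y a f g.
- move=> y k; apply/funext => x; rewrite /T/w/=.
  by rewrite (chiD k _ _ (svalP x) (svalP y)) mulrC -scalerA.
- move=> a b ab /wE va /wE vb.
  by have [x Mx] := sep _ _ ab va vb; exists (exist _ x Mx).
- apply/funext => x; rewrite fct_sumE; apply: v0; exact: svalP.
Qed.

(* In the application [A k] is the projection onto the component of degree [-k]
   of a grading by [W / M]; the ungraded case is [M = W] and [A k = 1]. *)
Section Spectral.
Variables (F : fieldType) (W U G : zmodType) (H : vectType F) (I J : finType).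
Variables (e : W -> U -> F) (cls : {additive W -> G}) (pt : J -> U).
Variables (M N : set W) (X : set U) (u : U) (A : W -> 'End(H)).
Variables (w : I -> W) (ss : I -> seq W) (m : I -> W -> F) (Pi : I -> 'End(H)).

Hypothesis eDl : forall j k x, e (j + k) x = e j x * e k x.
Hypothesis eDr : forall k x y, e k (x + y) = e k x * e k y.
Hypothesis e0l : forall x, e 0 x = 1.
Hypothesis e0r : forall k, e k 0 = 1.
Hypothesis e_nondeg : forall x, (forall k, e k x = 1) -> x = 0.
Hypothesis cls_surj : forall g, exists k, cls k = g.
Hypothesis pt_inj : injective pt.
Hypothesis fourier : forall f : G -> H, exists v : J -> H,
  forall k, f (cls k) = \sum_a e (- k) (pt a) *: v a.

(** In the application W is the weight lattice, U the torus, G the quotient W_l and N the lattice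
    R_a. So [T] becomes T_{R_a}; in the graded case [Mperp] becomes T_R and X represents the
    quotient of the two. *)
Let T : set U := [set c | forall j, N j -> e j c = 1].
Let Mperp : set U := [set c | forall j, M j -> e j c = 1].

Hypothesis M0 : M 0.
Hypothesis MB : forall j k, M j -> M k -> M (j - k).
Hypothesis NM : N `<=` M.
Hypothesis ptT : forall c, T c -> exists a, pt a = u + c.
Hypothesis pt_shift : forall a c, Mperp c -> exists b, pt b = pt a + c.
Hypothesis kerN : forall k, cls k = 0 -> N k.
Hypothesis ker_u : forall k, cls k = 0 -> e k u = 1.
Hypothesis XT : X `<=` T.
Hypothesis X_rep : forall c, T c -> exists2 x, X x & Mperp (c - x).
Hypothesis X_uniq : forall x y, X x -> X y -> Mperp (x - y) -> x = y.
Hypothesis AM : forall k j, M j -> A (k + j) = A k.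
Hypothesis AA : forall k v, A k (A k v) = A k v.
Hypothesis A_orth : forall k k' v, ~ M (k - k') -> A k (A k' v) = 0.
Hypothesis A_faithful : forall v, (forall k, A k v = 0) -> v = 0.
Hypothesis ssM : forall i s, s \in ss i -> M (w i - s).
Hypothesis PiA : forall i k v, Pi i (A k v) = A (k - w i) (Pi i v).

Let chi i x := \sum_(s <- ss i) m i s * e s x.

Definition eigen_space x : {vspace H} :=
  (\bigcap_i lker (Pi i - chi i x *: \1)%VF)%VS.

Lemma eigen_spaceP x v :
  reflect (forall i, Pi i v = chi i x *: v) (v \in eigen_space x).
Proof.
have kerE i : (v \in lker (Pi i - chi i x *: \1)%VF) = (Pi i v == chi i x *: v).
  by rewrite memv_ker add_lfunE opp_lfunE scale_lfunE id_lfunE subr_eq0.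
rewrite memvE; apply: (iffP subv_bigcapP) => h i => [|_].
  by have := h i isT; rewrite -memvE kerE => /eqP.
by rewrite -memvE kerE h.
Qed.

Let e_neq0 k x : e k x != 0.
Proof.
apply/eqP => ek; have := e0l x; rewrite -(subrr k) eDl ek mul0r => /eqP.
by rewrite eq_sym oner_eq0.
Qed.

Let eNl k x : e (- k) x = (e k x)^-1.
Proof. by apply: (mulIf (e_neq0 k x)); rewrite -eDl addNr e0l mulVf. Qed.

Let eNr k x : e k (- x) = (e k x)^-1.
Proof. by apply: (mulIf (e_neq0 k x)); rewrite -eDr addNr e0r mulVf. Qed.

(** By [e_nondeg] distinct points [pt a] give distinct characters of W, and these are
    independent. *)
Let coeff_uniq (v v' : J -> H) :
  (forall k, \sum_a e (- k) (pt a) *: v a = \sum_a e (- k) (pt a) *: v' a) ->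
  forall a, v a = v' a.
Proof.
move=> vv' a; apply/eqP; rewrite -subr_eq0; apply/eqP; move: a.
apply: (@characters_free _ _ W setT J (fun a k => e (- k) (pt a))) => //.
- by move=> j x y _ _; rewrite opprD eDl.
- by move=> j; rewrite oppr0 e0l.
- move=> a b ab _ _; apply: contrapT => nab; case/eqP: ab; apply: pt_inj.
  apply/eqP; rewrite -subr_eq0; apply/eqP/e_nondeg => k; rewrite eDr eNr.
  have [kab|kab] := eqVneq (e k (pt a)) (e k (pt b)); first by rewrite kab mulfV.
  by case: nab; exists (- k) => //=; rewrite opprK.
- move=> k _; under eq_bigr do rewrite scalerBr.
  by rewrite sumrB vv' subrr.
Qed.

(** The three conditions are the equations of the root space, the degree condition on the values,
    and the translation equations at u. *)
Definition spectral_set : set (G -> H) :=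
  [set f | [/\ forall i g, \sum_(s <- ss i) m i s *: f (g - cls s) = Pi i (f g),
    forall k, A k (f (cls k)) = f (cls k) &
    forall j, N j -> forall g, f (g + cls j) = e (- j) u *: f g]].

Let rep g := projT1 (cid (cls_surj g)).
Let repK g : cls (rep g) = g. Proof. by rewrite /rep; case: cid. Qed.

(* Independent of the representative [rep g] when [pt a] is in [u + T]. *)
Let Phi a v : G -> H := fun g => e (- rep g) (pt a) *: A (rep g) v.

Let PhiE a v k : T (pt a - u) -> Phi a v (cls k) = e (- k) (pt a) *: A k v.
Proof.
move=> Ta; rewrite /Phi; set k' := rep _.
have kk : cls (k' - k) = 0 by rewrite raddfB/= /k' repK subrr.
have e1 : e (k' - k) (pt a) = 1.
  rewrite -[pt a](subrK u) eDr ker_u// mulr1; exact/Ta/kerN.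
have -> : k' = k + (k' - k) by rewrite addrC subrK.
rewrite AM; last exact/NM/kerN.
by rewrite opprD eDl [e (- (k' - k)) _]eNl e1 invr1 mulr1.
Qed.

Let inX a := `[< X (pt a - u) >].
(** The zero space outside u + X lets all of J index the decomposition. *)
Let E a : {vspace H} := if inX a then eigen_space (pt a) else 0%VS.

Let Phi_sumE (v : J -> H) k : (forall a, v a \in E a) ->
  (\sum_a Phi a (v a)) (cls k) = \sum_a e (- k) (pt a) *: A k (v a).
Proof.
move=> vE; rewrite fct_sumE; apply: eq_bigr => a _.
have := vE a; rewrite /E; case: ifPn => [/asboolP Xa _|_].
  by rewrite PhiE//; exact: XT.
by rewrite memv0 => /eqP ->; rewrite /Phi !linear0 ?scaler0.
Qed.

(** On a coset k + M the projection is constantly [A k], so the vanishing sum is a relation between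
    characters of M with vectors [A k (v a)]. Points of u + X are distinct modulo [Mperp], hence
    each [A k (v a)] vanishes, for every k. *)
Let Phi_inj (v : J -> H) : (forall a, v a \in E a) ->
  \sum_a Phi a (v a) = 0 -> forall a, v a = 0.
Proof.
move=> vE v0 a; apply: A_faithful => k.
have vX b : v b != 0 -> X (pt b - u).
  have := vE b; rewrite /E; case: ifPn => [/asboolP//|_].
  by rewrite memv0 => ->.
suff : e (- k) (pt a) *: A k (v a) = 0.
  by move=> /eqP; rewrite scaler_eq0 (negPf (e_neq0 _ _)) => /eqP.
move: a; apply: (@characters_free _ _ W M J (fun a k => e (- k) (pt a))) => //.
- by move=> x y Mx My; rewrite -[y]opprK; apply: MB => //; rewrite -sub0r; exact: MB.
- by move=> j x y _ _; rewrite opprD eDl.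
- by move=> j; rewrite oppr0 e0l.
- have nz b : e (- k) (pt b) *: A k (v b) != 0 -> v b != 0.
    by apply: contraNN => /eqP ->; rewrite linear0 ?scaler0.
  move=> a b ab /nz/vX Xa /nz/vX Xb; apply: contrapT => nab; case/eqP: ab.
  apply: pt_inj; apply: (addIr (- u)); apply: X_uniq => // j Mj.
  rewrite opprB addrA subrK eDr eNr.
  have [jab|jab] := eqVneq (e j (pt a)) (e j (pt b)); first by rewrite jab mulfV.
  case: nab; exists (- j); last by rewrite opprK.
  by rewrite -sub0r; exact: MB.
- move=> j Mj.
  transitivity ((\sum_a Phi a (v a)) (cls (k + j))); last by rewrite v0.
  rewrite Phi_sumE//; apply: eq_bigr => a _.
  by rewrite AM// opprD eDl scalerA mulrC.
Qed.

Let Phi_spectral (v : J -> H) : (forall a, v a \in E a) ->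
  spectral_set (\sum_a Phi a (v a)).
Proof.
move=> vE.
have vX b : v b != 0 -> X (pt b - u).
  have := vE b; rewrite /E; case: ifPn => [/asboolP//|_].
  by rewrite memv0 => ->.
have vEig b i : Pi i (v b) = chi i (pt b) *: v b.
  have := vE b; rewrite /E; case: ifPn => [_ /eigen_spaceP//|_].
  by rewrite memv0 => /eqP ->; rewrite linear0 ?scaler0.
split.
- move=> i g; rewrite -(repK g); move: (rep g) => k {g}.
  transitivity (\sum_(s <- ss i) \sum_a
      (e (- k) (pt a) * (m i s * e s (pt a))) *: A (k - w i) (v a)).
    rewrite big_seq [RHS]big_seq; apply: eq_bigr => s sI.
    rewrite -raddfB/= Phi_sumE// scaler_sumr; apply: eq_bigr => a _.
    rewrite scalerA opprB addrC eDl; congr (_ *: _); first by ring.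
    (* All weights s of one representation lie in the coset of [w i] modulo M, so the same
       projection [A (k - w i)] occurs in every term and the sum over s becomes the scalar
       [chi i]. *)
    by rewrite -(AM (k - w i) (ssM sI)) addrA subrK.
  rewrite exchange_big/= Phi_sumE// raddf_sum/=; apply: eq_bigr => a _.
  rewrite -scaler_suml -mulr_sumr linearZ/= PiA vEig linearZ/= scalerA//.
- move=> k; rewrite Phi_sumE// raddf_sum/=.
  by apply: eq_bigr => a _; rewrite linearZ/= AA.
- move=> j Nj g; rewrite -(repK g); move: (rep g) => k {g}.
  rewrite -raddfD/= !Phi_sumE// scaler_sumr; apply: eq_bigr => a _.
  have [->|va] := eqVneq (v a) 0; first by rewrite !linear0 ?scaler0.
  rewrite AM; last exact: NM.
  rewrite opprD eDl scalerA mulrC; congr (_ * _ *: _).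
  rewrite !eNl -[pt a](subrK u) eDr (XT (vX _ va) Nj) mul1r//.
Qed.

(** After applying [A k], all nonzero coefficients in one coset of [Mperp] contribute the same term
    by [vM]. Each coset therefore contributes the term of its representative b times the number
    [n b] of its nonzero coefficients. *)
Let Phi_surj f : spectral_set f ->
  exists2 v : J -> H, (forall a, v a \in E a) & f = \sum_a Phi a (v a).
Proof.
move=> [fD fA fN]; have [v fv] := fourier f.
(* Comparing the coefficients of the translate of f by j with those of its multiple shows that
   [pt a] and u agree on j wherever [v a] is nonzero. *)
have vT a : v a != 0 -> T (pt a - u).
  move=> va j Nj.
  have : e (- j) (pt a) *: v a = e (- j) u *: v a.
    move: a {va}; apply: coeff_uniq => k.
    transitivity (f (cls (k + j))).
      by rewrite fv; apply: eq_bigr => a _; rewrite opprD eDl scalerA.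
    rewrite raddfD/= fN// fv scaler_sumr; apply: eq_bigr => a _.
    by rewrite !scalerA mulrC.
  move=> /eqP; rewrite -subr_eq0 -scalerBl scaler_eq0 (negPf va) orbF subr_eq0.
  by rewrite !eNl => /eqP/invr_inj; rewrite eDr eNr => ->; rewrite mulfV.
have vPi a : v a \in eigen_space (pt a).
  apply/eigen_spaceP => i; move: a; apply: coeff_uniq => k.
  transitivity (Pi i (f (cls k))).
    by rewrite fv raddf_sum/=; apply: eq_bigr => a _; rewrite linearZ.
  rewrite -fD; under eq_bigr => s _ do rewrite -raddfB/= fv scaler_sumr.
  rewrite exchange_big; apply: eq_bigr => a _ /=.
  rewrite scalerA mulr_sumr scaler_suml; apply: eq_bigr => s _.
  by rewrite opprB addrC eDl scalerA; congr (_ *: _); ring.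
(* Multiplying by a character trivial on M does not change the component of
   [f] in a fixed coset of M. *)
have vM c a b k : Mperp c -> pt b = pt a + c ->
    e (- k) c *: A k (v b) = A k (v a).
  move=> Mc; have /choice[sh shE] a' := pt_shift a' Mc.
  have sh_inj : injective sh.
    move=> x y xy; apply: pt_inj; apply: (addIr c); by rewrite -!shE xy.
  move=> ba; have -> : b = sh a by apply: pt_inj; rewrite shE.
  move: a {ba b}; apply: coeff_uniq => j.
  transitivity (e (j - k) c *: A k (f (cls j))).
    rewrite fv raddf_sum/= scaler_sumr [RHS](reindex_inj sh_inj)/=.
    apply: eq_bigr => a _; rewrite [A k (_ *: _)]linearZ/= !scalerA; congr (_ *: _).
    by rewrite shE !eDr !eDl !eNl; field; rewrite !e_neq0.
  transitivity (A k (f (cls j))); last first.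
    by rewrite fv raddf_sum/=; apply: eq_bigr => a _; rewrite linearZ.
  (* If j - k is in M the factor [e (j - k) c] is 1; otherwise the value of f at j has another
     degree and [A k] kills it. *)
  have [Mjk|nM] := pselect (M (j - k)); first by rewrite Mc// scale1r.
  rewrite -fA A_orth ?scaler0// => Mkj; apply: nM.
  by rewrite -opprB -sub0r; exact: MB.
have /choice[rr rrP] a : exists b, v a != 0 ->
    X (pt b - u) /\ Mperp (pt a - pt b).
  have [va|va] := eqVneq (v a) 0; first by exists a.
  have [x Xx Mx] := X_rep (vT _ va); have [b bE] := ptT (XT Xx).
  exists b => _; rewrite bE addrC addKr; split=> //.
  by rewrite opprD addrA.
(* Only nonzero coefficients are counted, since [rr a] is arbitrary for the others; this also forces
   [n b] to vanish when [pt b] is outside u + X. *)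
pose n b := #|[set a | (v a != 0) && (rr a == b)]%SET|.
exists (fun b => (n b)%:R *: v b).
  move=> b; rewrite /E; case: ifPn => [_|/asboolPn nX].
    exact: rpredZ.
  rewrite memv0 (_ : n b = 0%N) ?scale0r//; apply/eqP; rewrite cards_eq0.
  apply/eqP/setP => a; rewrite !inE; apply/negP => /andP[va /eqP ab].
  by have [] := rrP a va; rewrite ab.
apply/funext => g; rewrite -(repK g); move: (rep g) => k {g}.
rewrite fct_sumE -fA fv raddf_sum/=.
pose h b : H := e (- k) (pt b) *: A k (v b).
transitivity (\sum_(a | v a != 0) h (rr a)).
  rewrite [RHS]big_mkcond; apply: eq_bigr => a _; rewrite [A k (_ *: _)]linearZ/=.
  case: ifPn => [va|/negPn/eqP ->]; last by rewrite linear0 ?scaler0.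
  have [_ Ma] := rrP a va.
  rewrite /h -(vM (pt a - pt (rr a)) (rr a) a k Ma); last by rewrite addrC subrK.
  by rewrite scalerA -eDr addrC subrK.
rewrite (partition_big rr xpredT)//=; apply: eq_bigr => b _.
rewrite (eq_bigr (fun=> h b)) => [|a /andP[_ /eqP ->]//].
have [nX|nX] := eqVneq (n b) 0%N.
  rewrite nX scale0r /Phi !linear0 ?scaler0.
  rewrite big_pred0// => a; have := cards0_eq nX => /setP/(_ a).
  by rewrite !inE.
have [a] : exists a, a \in [set a | (v a != 0) && (rr a == b)]%SET.
  by apply/set0Pn; rewrite -cards_eq0.
rewrite inE => /andP[va /eqP ab].
rewrite PhiE; last by apply: XT; rewrite -ab; case: (rrP a va).
rewrite linearZ/= scalerA mulrC -scalerA scaler_nat -/(h b) sumr_const.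
by congr (_ *+ _); apply: eq_card => x; rewrite !inE.
Qed.

Lemma sdim_spectral_set :
  sdim spectral_set = (\sum_(a | inX a) \dim (eigen_space (pt a)))%N.
Proof.
rewrite (@sdim_linear_image _ _ _ J E Phi).
- rewrite [RHS]big_mkcond; apply: eq_bigr => a _.
  by rewrite /E; case: ifP; rewrite ?dimv0.
- move=> a c x y; apply/funext => g.
  by rewrite /Phi [A (rep g) _]linearP/= scalerDr scalerA mulrC -scalerA.
- exact: Phi_inj.
- move=> f; split; first exact: Phi_surj.
  by move=> [v vE ->]; exact: Phi_spectral.
Qed.

End Spectral.

(** * Strings of roots *)

Section LieBracket.
Variables (F : fieldType) (g : lmodType F) (br : g -> g -> g).
Hypothesis br_lie : is_lie_bracket br.
Hypothesis lie_brDr : forall x y z, br x (y + z) = br x y + br x z.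

Lemma lie_brP a x y z : br (a *: x + y) z = a *: br x z + br y z.
Proof. by case: br_lie. Qed.

Lemma lie_brxx x : br x x = 0. Proof. by case: br_lie. Qed.

Lemma lie_brDl x y z : br (x + y) z = br x z + br y z.
Proof. by rewrite -[x]scale1r lie_brP !scale1r. Qed.

Lemma lie_br0l z : br 0 z = 0.
Proof. by apply: (@addrI _ (br 0 z)); rewrite -lie_brDl !addr0. Qed.

Lemma lie_brZl a x z : br (a *: x) z = a *: br x z.
Proof. by rewrite -[a *: x]addr0 lie_brP lie_br0l addr0. Qed.

Lemma lie_brC x y : br x y = - br y x.
Proof.
apply/eqP; rewrite -addr_eq0.
have := lie_brxx (x + y).
by rewrite lie_brDl !lie_brDr !lie_brxx add0r addr0 => ->.
Qed.

Lemma lie_brZr a x y : br x (a *: y) = a *: br x y.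
Proof. by rewrite lie_brC lie_brZl -scalerN -lie_brC. Qed.

Lemma lie_br0r x : br x 0 = 0. Proof. by rewrite lie_brC lie_br0l oppr0. Qed.

Lemma lie_brNr x y : br x (- y) = - br x y.
Proof. by rewrite -scaleN1r lie_brZr scaleN1r. Qed.

Lemma lie_brNl x y : br (- x) y = - br x y.
Proof. by rewrite -scaleN1r lie_brZl scaleN1r. Qed.

Lemma lie_ad_linear x : linear (br x).
Proof. by move=> a y z; rewrite lie_brDr lie_brZr. Qed.

Lemma lie_ad_bracket x y z : br (br x y) z = br x (br y z) - br y (br x z).
Proof.
have [_ _ /(_ x y z)] := br_lie.
rewrite [br z (br x y)]lie_brC [br z x]lie_brC lie_brNr => /eqP.
by rewrite subr_eq0 => /eqP.
Qed.

Lemma lie_ad_derivation x y z : br x (br y z) = br (br x y) z + br y (br x z).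
Proof. by rewrite lie_ad_bracket subrK. Qed.

End LieBracket.

Section Sl2.
Variables (F : numFieldType) (V : lmodType F) (E Fo h : V -> V).
Hypothesis El : linear E.
Hypothesis Fl : linear Fo.
Hypothesis EF : forall x, E (Fo x) - Fo (E x) = h x.
Hypothesis hE : forall x, h (E x) - E (h x) = 2 *: E x.
Hypothesis hF : forall x, h (Fo x) - Fo (h x) = - 2 *: Fo x.
(** This stands in for finite dimension. The iterates of E and Fo on an eigenvector of h have
    eigenvalues moving in steps of 2, so some iterate must vanish. *)
Hypothesis h_fin : forall (v : nat -> V) (c : nat -> F), injective c ->
  (forall n, h (v n) = c n *: v n) -> exists n, v n = 0.

Let linZ (T : V -> V) a x : linear T -> T (a *: x) = a *: T x.
Proof. by move=> Tl; rewrite -[a *: x]addr0 Tl linear_map0// addr0. Qed.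

Let hE_iter lam v n : h v = lam *: v ->
  h (iter n E v) = (lam + 2 * n%:R) *: iter n E v.
Proof.
move=> hv; elim: n => [|n IH]/=; first by rewrite mulr0 addr0.
apply/eqP; rewrite -subr_eq0 -[h _](subrK (E (h (iter n E v)))) hE IH linZ//.
by rewrite -scalerDl -scalerBl (_ : _ - _ = 0) ?scale0r// -natr1; ring.
Qed.

Let hF_iter lam v n : h v = lam *: v ->
  h (iter n Fo v) = (lam - 2 * n%:R) *: iter n Fo v.
Proof.
move=> hv; elim: n => [|n IH]/=; first by rewrite mulr0 subr0.
apply/eqP; rewrite -subr_eq0 -[h _](subrK (Fo (h (iter n Fo v)))) hF IH linZ//.
by rewrite -scalerDl -scalerBl (_ : _ - _ = 0) ?scale0r// -natr1; ring.
Qed.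

Let EF_iter lam v n : h v = lam *: v -> E v = 0 ->
  E (iter n.+1 Fo v) = (n.+1%:R * (lam - n%:R)) *: iter n Fo v.
Proof.
move=> hv Ev; elim: n => [|n IH].
  by rewrite -[LHS](subrK (Fo (E v))) EF hv Ev linear_map0// addr0 mul1r subr0.
rewrite -[LHS](subrK (Fo (E (iter n.+1 Fo v)))) EF IH linZ//. rewrite (hF_iter n.+1 hv).
by rewrite -scalerDl; congr (_ *: _); rewrite -!natr1; ring.
Qed.

(* Climb from [v] to a primitive vector E^p v, of weight M, and descend. *)
Lemma sl2_string lam v : v != 0 -> h v = lam *: v ->
  exists p M, [/\ lam = M%:R - 2 * p%:R, E (iter p E v) = 0 &
    forall j, (j <= M)%N -> iter j Fo (iter p E v) != 0].
Proof.
move=> v0 hv.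
have inj2 (a : F) : injective (fun n : nat => a + 2 * n%:R).
  move=> m n /addrI/(mulfI _) mn; apply/eqP; rewrite -(eqr_nat F).
  by rewrite mn// pnatr_eq0.
have inj2N (a : F) : injective (fun n : nat => a - 2 * n%:R).
  move=> m n /addrI/oppr_inj/(mulfI _) mn; apply/eqP; rewrite -(eqr_nat F).
  by rewrite mn// pnatr_eq0.
have exE : exists n, iter n E v == 0.
  have [n n0] := h_fin (inj2 lam) (fun n => hE_iter n hv).
  by exists n; apply/eqP.
case: (ex_minnP exE) => -[|p]; first by rewrite (negPf v0).
move=> /eqP Ep pmin; set w := iter p E v.
have w0 : w != 0 by apply/negP => /pmin; rewrite ltnn.
have hw := hE_iter p hv : h w = _ *: w.
have exF : exists n, iter n Fo w == 0.
  have [n n0] := h_fin (inj2N _) (fun n => hF_iter n hw).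
  by exists n; apply/eqP.
case: (ex_minnP exF) => -[|M]; first by rewrite (negPf w0).
move=> /eqP FM Mmin; exists p, M; split=> //; last first.
  by move=> j jM; apply/negP => /Mmin; rewrite ltnNge jM.
(* Applying E to the vanishing vector F^(M+1) w gives (M + 1)(mu - M) F^M w = 0, where mu = lam + 2p
   is the weight of w; hence mu = M. *)
have := EF_iter M hw Ep; rewrite FM linear_map0// => /esym/eqP.
rewrite scaler_eq0 mulf_eq0 pnatr_eq0/= subr_eq0 => /orP[/eqP <-|/Mmin].
  by rewrite addrK.
by rewrite ltnn.
Qed.

End Sl2.

Section RootTheory.
Variables (R : realType) (D : lie_data R).
Hypothesis hD : simple_lie_data D.

Local Notation V := (kalg D).
Local Notation tt := (Defs.tt D).
Local Notation br := (@kbr R D).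
Local Notation gbr := (@gbr R D).
Implicit Types (r s H : tt) (z w : gc D).

Lemma kdotC (x y : V) : kdot D x y = kdot D y x.
Proof. by rewrite hermC expr0 mul1r. Qed.

Lemma kdot_gt0 (x : V) : x != 0 -> 0 < kdot D x x.
Proof. exact: neq0_dnorm_gt0. Qed.

Lemma dotC r s : dot r s = dot s r. Proof. exact: kdotC. Qed.

Lemma dotDl r s H : dot (r + s) H = dot r H + dot s H.
Proof. by rewrite /dot raddfD/= linearDl. Qed.

Lemma dotZl a r H : dot (a *: r) H = a * dot r H.
Proof. by rewrite /dot linearZ/= linearZl_LR. Qed.

Lemma dotNl r H : dot (- r) H = - dot r H.
Proof. by rewrite -scaleN1r dotZl mulN1r. Qed.

Lemma dotBl r s H : dot (r - s) H = dot r H - dot s H.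
Proof. by rewrite dotDl dotNl. Qed.

Lemma dotDr r s H : dot r (s + H) = dot r s + dot r H.
Proof. by rewrite dotC dotDl !(dotC _ r). Qed.

Lemma dotZr a r H : dot r (a *: H) = a * dot r H.
Proof. by rewrite dotC dotZl dotC. Qed.

Lemma dotNr r H : dot r (- H) = - dot r H.
Proof. by rewrite dotC dotNl dotC. Qed.

Lemma dotBr r s H : dot r (s - H) = dot r s - dot r H.
Proof. by rewrite dotDr dotNr. Qed.

Lemma dot0l H : dot 0 H = 0. Proof. by rewrite -(scale0r 0) dotZl mul0r. Qed.

Lemma dot0r H : dot H 0 = 0. Proof. by rewrite dotC dot0l. Qed.

Lemma dot_suml (I : Type) (s : seq I) (P : pred I) (f : I -> tt) H :
  dot (\sum_(i <- s | P i) f i) H = \sum_(i <- s | P i) dot (f i) H.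
Proof. exact: (big_morph _ (fun r s => dotDl r s H) (dot0l H)). Qed.

Lemma dot_gt0 r : r != 0 -> 0 < dot r r.
Proof. by move=> r0; apply: kdot_gt0; apply: contra_neq r0 => r0; exact: val_inj. Qed.

Lemma dot_eq0 r : (dot r r == 0) = (r == 0).
Proof.
have [->|/dot_gt0/gt_eqF->//] := eqVneq r 0; by rewrite dot0l eqxx.
Qed.

Lemma dot_nondeg r : (forall H, dot r H = 0) -> r = 0.
Proof. by move/(_ r)/eqP; rewrite dot_eq0 => /eqP. Qed.

Let kl := kbr_lie hD.

(* [is_lie_bracket] only asks for linearity in the first argument; additivity in
   the second one comes from the invariance of the inner product. *)
Let kbrDr (x y z : V) : br x (y + z) = br x y + br x z.
Proof.
have E u : kdot D (br x (y + z)) u = kdot D (br x y + br x z) u.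
  by rewrite linearDl/= !(kdot_invariant hD) (lie_brDl kl) raddfD.
apply/eqP; rewrite -subr_eq0; apply/negPn/negP => /kdot_gt0.
by rewrite linearBl/= E subrr ltxx.
Qed.

Let gl : is_lie_bracket gbr. Proof. by case: (gbr_simple hD). Qed.

Let gbrDr z w w' : gbr z (w + w') = gbr z w + gbr z w'.
Proof.
case: z w w' => [x x'] [y y'] [u u'].
by rewrite /gbr/cplx_bracket/= !kbrDr opprD; congr (_, _); rewrite addrACA.
Qed.

Lemma gc_scaleE (a : R[i]) (x y : V) : a *: ((x, y) : gc D) =
  (complex.Re a *: x - complex.Im a *: y, complex.Re a *: y + complex.Im a *: x).
Proof. by []. Qed.

(** Unlike in [is_root], both s and z may vanish, so that brackets and iterates of root vectors are
    again covered. *)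
Definition root_vec s z : Prop :=
  forall H, gbr (vsval H, 0) z = (0 +i* dot s H) *: z.

(** Complex conjugation with respect to the compact form; it exchanges the root spaces of r and
    -r. *)
Definition gconj z : gc D := (z.1, - z.2).

Lemma root_vecP s z : root_vec s z <->
  forall H, br (vsval H) z.1 = - (dot s H *: z.2) /\ br (vsval H) z.2 = dot s H *: z.1.
Proof.
case: z => x y; split=> h H; have := h H.
  rewrite /gbr/cplx_bracket/= !(lie_br0l kl) subr0 addr0 => -[-> ->].
  by rewrite !scale0r sub0r add0r.
move=> /= [h1 h2]; rewrite /gbr/cplx_bracket/= !(lie_br0l kl) subr0 addr0 h1 h2.
by rewrite gc_scaleE/= !scale0r sub0r add0r.
Qed.

Lemma root_vec_conj s z : root_vec s z -> root_vec (- s) (gconj z).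
Proof.
move=> /root_vecP h; apply/root_vecP => H; have [h1 h2] := h H; split=> /=.
  by rewrite dotNl scaleNr scalerN opprK h1.
by rewrite (lie_brNr kl) // h2 dotNl scaleNr.
Qed.

Lemma root_vec_bracket s s' z z' :
  root_vec s z -> root_vec s' z' -> root_vec (s + s') (gbr z z').
Proof.
move=> h h' H; rewrite (lie_ad_derivation gl)// h h' (lie_brZl gl) (lie_brZr gl)//.
rewrite -scalerDl dotDl; congr (_ *: _).
by apply/eqP; rewrite eq_complex/= addr0 !eqxx.
Qed.

Lemma root_vecZ s a z : root_vec s z -> root_vec s (a *: z).
Proof. by move=> h H; rewrite (lie_brZr gl)// h !scalerA mulrC. Qed.

Lemma root_vec_cartan s H H' z : root_vec s z ->
  gbr (vsval H, vsval H') z = (- dot s H' +i* dot s H) *: z.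
Proof.
move=> h.
have -> : (vsval H, vsval H') =
    (vsval H, 0) + (0 +i* 1) *: ((vsval H', 0) : gc D) :> gc D.
  rewrite gc_scaleE/= !scale0r !scale1r subr0 add0r.
  by congr (_, _); rewrite ?addr0 ?add0r.
rewrite (lie_brDl gl) (lie_brZl gl) !h scalerA -scalerDl; congr (_ *: _).
by apply/eqP; rewrite eq_complex/=; apply/andP; split; apply/eqP; ring.
Qed.

(** Real and imaginary parts of z both commute with the torus, which is maximal. *)
Lemma root_vec0 z : root_vec 0 z -> z.1 \in tor D /\ z.2 \in tor D.
Proof.
move=> /root_vecP h; split; apply: (tor_maximal hD) => y yT.
  have [h1 _] := h (vsproj (tor D) y); rewrite vsprojK// dot0l scale0r oppr0 in h1.
  by rewrite (lie_brC kl)// h1 oppr0.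
have [_ h2] := h (vsproj (tor D) y); rewrite vsprojK// dot0l scale0r in h2.
by rewrite (lie_brC kl)// h2 oppr0.
Qed.

Lemma is_rootN r : is_root r -> is_root (- r).
Proof.
move=> [r0 [z z0 h]]; split; first by move/eqP; rewrite oppr_eq0 => /eqP.
exists (gconj z); last exact: root_vec_conj.
move: z0; case: (z) => x y z0 [x0 /eqP]; rewrite oppr_eq0 => /eqP y0.
by apply: z0; rewrite x0 y0.
Qed.

Lemma root_sl2 r : is_root r -> exists e f,
  [/\ root_vec r e, root_vec (- r) f, f != 0 & gbr e f = (0, - vsval (coroot r))].
Proof.
move=> [/eqP r0 [[x y] z0 hz]]; have /root_vecP/= h := hz.
have rr := dot_gt0 r0.
have x0 : x != 0.
  apply/eqP => x0; apply: z0; have [] := h r.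
  rewrite x0 (lie_br0r kl)// => /esym/eqP; rewrite oppr_eq0 scaler_eq0 gt_eqF//=.
  by move=> /eqP ->.
have xx := kdot_gt0 x0.
have xyT : br x y \in tor D.
  apply: (tor_maximal hD) => y' y'T; rewrite (lie_brC kl)// (lie_ad_derivation kl)//.
  have := h (vsproj (tor D) y'); rewrite vsprojK// => -[-> ->].
  rewrite (lie_brNl kl) (lie_brZl kl) (lie_brZr kl)// !(lie_brxx kl).
  by rewrite !scaler0 oppr0 addr0 oppr0.
have xyE : br x y = vsval (- (kdot D x x *: r)).
  rewrite -(vsprojK xyT); congr vsval; apply/eqP; rewrite -subr_eq0 opprK.
  apply/eqP/dot_nondeg => H; rewrite dotDl dotZl /dot vsprojK//.
  rewrite (kdot_invariant hD) (lie_brC kl)//; have [_ ->] := h H.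
  by rewrite linearN linearZ/= -/(dot r H) mulrC addNr.
(* With e = x + i y, the bracket of e with its conjugate is -2i [x, y] = 2i |x|^2 r. The factor -c
   turns it into -i H_r, which acts on weight s by the real number <s, H_r>. *)
pose c := (kdot D x x * dot r r)^-1.
exists (x, y), (- c%:C *: gconj (x, y)); split=> //.
- exact/root_vecZ/root_vec_conj.
- rewrite scaler_eq0 oppr_eq0 negb_or; apply/andP; split.
    by rewrite eq_complex/= eqxx andbT invr_eq0 mulf_neq0// gt_eqF.
  by apply/negP => /eqP[/eqP]; rewrite (negPf x0).
- rewrite (lie_brZr gl)// /gbr/cplx_bracket/=.
  rewrite !(lie_brNr kl)// [br y x](lie_brC kl)// !(lie_brxx kl) xyE.
  rewrite gc_scaleE/= !oppr0 !scale0r ?scaler0 ?subr0 ?addr0 ?sub0r.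
  rewrite scaler0 !opprK -scalerDl scalerA -scaleNr; congr (_, _ *: _).
  by rewrite /c; field; rewrite !gt_eqF.
Qed.

(** Independence over the complex numbers implies independence over the reals, so the dimension of
    the real space underlying [gc] bounds the number of distinct eigenvalues. *)
Lemma gc_finite (T : gc D -> gc D) (v : nat -> gc D) (c : nat -> R[i]) :
  linear T -> injective c -> (forall n, T (v n) = c n *: v n) ->
  exists n, v n = 0.
Proof.
move=> Tl cinj Tv; apply: contrapT => /forallNP v0.
pose n := (\dim (fullv : {vspace (V * V)%type})).+1.
pose X := [tuple (v i : (V * V)%type) | i < n].
have fX : free X.
  apply/freeP => a; under eq_bigr do rewrite nth_mktuple.
  move=> a0 i.
  have {}a0 : \sum_(j < n) ((a j)%:C *: v j : gc D) = 0.
    rewrite -[RHS]a0; apply: eq_bigr => j _; case: (v j) => x y.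
    by rewrite gc_scaleE/= !scale0r subr0 addr0.
  have := @joint_eigenvectors_free _ _ unit (fun=> T) _ (fun (j : 'I_n) _ => c j)
    (fun=> Tl) (fun j => (a j)%:C *: v j).
  move=> /(_ _ _ a0 i) H; have /eqP : (a i)%:C *: v i = 0.
    apply: H => [_ j|j k jk _ _].
      by rewrite -[_ *: v j]addr0 Tl linear_map0// Tv !addr0 !scalerA mulrC.
    exists Datatypes.tt; apply: contra_neq jk => /cinj jk; exact: val_inj.
  rewrite scaler_eq0 => /orP[|/eqP/(v0 i)//].
  by rewrite eq_complex/= eqxx andbT => /eqP.
have := dimvS (subvf (span X)); rewrite (eqP fX) size_tuple /n.
by rewrite ltnn.
Qed.

Section Strings.
Variables (r : tt) (e f : gc D).
Hypothesis re : root_vec r e.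
Hypothesis rf : root_vec (- r) f.
Hypothesis ef : gbr e f = (0, - vsval (coroot r)).

Lemma root_vec_iterE s z n : root_vec s z ->
  root_vec (s + r *+ n) (iter n (gbr e) z).
Proof.
move=> h; elim: n => [|n IH] /=; first by rewrite addr0.
by rewrite mulrS addrCA; exact: root_vec_bracket.
Qed.

Lemma root_vec_iterF s z n : root_vec s z ->
  root_vec (s - r *+ n) (iter n (gbr f) z).
Proof.
move=> h; elim: n => [|n IH] /=; first by rewrite subr0.
by rewrite mulrS opprD addrCA; exact: root_vec_bracket.
Qed.

Lemma coroot_self : r != 0 -> dot r (coroot r) = 2.
Proof. by move=> r0; rewrite /coroot dotZr mulfVK// dot_eq0. Qed.

Lemma root_h_act s z : root_vec s z ->
  gbr (0, - vsval (coroot r)) z = (dot s (coroot r))%:C *: z.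
Proof.
by move=> /(root_vec_cartan 0 (- coroot r)); rewrite !raddfN raddf0 dotNr opprK dot0r.
Qed.

(** [sl2_string] for the brackets with e, f and -i H_r. The j-th vector of the string has weight s +
    (p - j) r. *)
Lemma root_string s z : r != 0 -> root_vec s z -> z != 0 -> exists p M : nat,
  [/\ dot s (coroot r) = M%:R - 2 * p%:R, iter p.+1 (gbr e) z = 0 &
    forall j, (j <= M)%N -> iter j (gbr f) (iter p (gbr e) z) != 0].
Proof.
move=> r0 hz z0; pose h := gbr (0, - vsval (coroot r)).
have comm (t : gc D) s' : root_vec s' t -> forall x, h (gbr t x) - gbr t (h x) =
    (dot s' (coroot r))%:C *: gbr t x.
  move=> ht x; rewrite /h (lie_ad_derivation gl)// addrK (root_h_act ht).
  by rewrite (lie_brZl gl).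
have El := lie_ad_linear gl gbrDr e.
have Fl := lie_ad_linear gl gbrDr f.
have hl : linear h by exact: lie_ad_linear.
have EF x : gbr e (gbr f x) - gbr f (gbr e x) = h x.
  by rewrite /h -ef (lie_ad_bracket gl).
have hE x : h (gbr e x) - gbr e (h x) = 2 *: gbr e x.
  by rewrite (comm _ _ re) coroot_self// rmorph_nat.
have hF x : h (gbr f x) - gbr f (h x) = - 2 *: gbr f x.
  by rewrite (comm _ _ rf) dotNl coroot_self// rmorphN rmorph_nat.
have h_fin v c := @gc_finite h v c hl.
have [p [M [pM Ep Mj]]] := sl2_string El Fl EF hE hF h_fin z0 (root_h_act hz).
exists p, M; split=> //.
by apply: (@complexI R); rewrite pM rmorphB rmorphM !rmorph_nat.
Qed.

End Strings.

Lemma root_coroot_int r s : is_root r -> is_root s ->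
  exists m : int, dot s (coroot r) = m%:~R.
Proof.
move=> rr [_ [z /eqP z0 hz]]; have [e [f [re rf _ ef]]] := root_sl2 rr.
case: rr => /eqP r0 _.
have [p [M [-> _ _]]] := root_string re rf ef r0 hz z0.
by exists (M%:Z - 2 * p%:Z); rewrite rmorphB rmorphM.
Qed.

Lemma corootN r : coroot (- r) = - coroot r.
Proof. by rewrite /coroot dotNl dotNr opprK scalerN. Qed.

Lemma dot_refl r s : r != 0 ->
  dot (s - dot s (coroot r) *: r) (s - dot s (coroot r) *: r) = dot s s.
Proof.
move=> r0; rewrite /coroot !(dotBl, dotBr, dotZl, dotZr) (dotC r s).
by field; rewrite dot_eq0.
Qed.

(** The reflected weight sits at position j = M - p of the string. If <s, H_r> is nonnegative then M
    >= 2p, so this position exists; otherwise -r, which has the same reflection, is used. *)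
Lemma root_reflection r s : is_root r -> is_root s ->
  is_root (s - dot s (coroot r) *: r).
Proof.
have main r' : is_root r' -> is_root s -> 0 <= dot s (coroot r') ->
    is_root (s - dot s (coroot r') *: r').
  move=> rr [/eqP s0 [z /eqP z0 hz]] pos; have [e [f [re rf _ ef]]] := root_sl2 rr.
  case: rr => /eqP r0 _.
  have [p [M [sE _ Mj]]] := root_string re rf ef r0 hz z0.
  split; first by apply/eqP; rewrite -dot_eq0 dot_refl// dot_eq0.
  have pM : (p <= M)%N.
    rewrite -(ler_nat R); have := pos; rewrite sE subr_ge0; apply: le_trans.
    by rewrite ler_peMl// ler1n.
  exists (iter (M - p) (gbr f) (iter p (gbr e) z)).
    by apply/eqP/Mj; exact: leq_subr.
  rewrite (_ : _ - _ = s + r' *+ p - r' *+ (M - p)); last first.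
    rewrite -addrA; congr (_ + _); rewrite sE -[r' *+ p]scaler_nat.
    rewrite -[r' *+ (M - p)]scaler_nat -scaleNr -scalerBl.
    by congr (_ *: _); rewrite natrB//; ring.
  exact/root_vec_iterF/root_vec_iterE.
move=> rr rs; have [pos|/ltW neg] := leP 0 (dot s (coroot r)); first exact: main.
have := main (- r) (is_rootN rr) rs.
by rewrite corootN dotNr scalerN scaleNr opprK oppr_ge0; exact.
Qed.

(* A vector z of weight 2r would generate a string of length 5 whose third
   element lies in the Cartan subalgebra; but then the fourth is a multiple of
   [f] and the fifth vanishes. *)
Lemma root_double r : is_root r -> ~ is_root (r *+ 2).
Proof.
move=> rr [_ [z /eqP z0 hz]]; have [e [f [re rf f0 ef]]] := root_sl2 rr.
have /eqP r0 := rr.1; have d0 : dot r r != 0 by rewrite dot_eq0.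
(* Otherwise 3r would be a root, but <r, H_{3r}> = 2/3 is not an integer. *)
have Ez : gbr e z = 0.
  apply: contrapT => /eqP ez0.
  have r3 : is_root (r *+ 3).
    split.
      by apply/eqP; rewrite -[r *+ 3]scaler_nat scaler_eq0 negb_or r0 pnatr_eq0.
    exists (gbr e z); first exact/eqP.
    by rewrite mulrS; exact: root_vec_bracket.
  have [m] := root_coroot_int r3 rr.
  have -> : dot r (coroot (r *+ 3)) = 2 / 3.
    rewrite /coroot -[r *+ 3]scaler_nat !(dotZl, dotZr); field; exact: d0.
  move/(congr1 (fun x => 3 * x)); rewrite mulrCA mulfV ?pnatr_eq0// mulr1.
  move=> /eqP; rewrite -[3]/((3 : int)%:~R) -[2]/((2 : int)%:~R) -intrM eqr_int.
  by move=> /eqP; lia.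
have [p [M [dE _ Mj]]] := root_string re rf ef r0 hz z0.
(* Since e kills z, the string already starts at z; its length parameter is then M = <2r, H_r> =
   4. *)
case: p => [|p] in dE Mj *; last first.
  have E0 n : iter n (gbr e) 0 = 0.
    by elim: n => //= n ->; exact: lie_br0r.
  by have := Mj 0%N isT; rewrite iterSr Ez/= E0 eqxx.
have M4 : M = 4%N.
  apply/eqP; rewrite -(eqr_nat R); move: dE; rewrite mulr0 subr0 => <-.
  by rewrite -[r *+ 2]scaler_nat dotZl coroot_self// -natrM.
have := Mj 2%N; have := Mj 4%N; rewrite M4 /= => /(_ isT) F4 /(_ isT) _.
move: F4; set x := gbr f (gbr f z).
have x0 : root_vec 0 x.
  have := root_vec_iterF rf 2 hz; rewrite subrr; exact.
have [x1 x2] := root_vec0 x0.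
have xE : x = (vsval (vsproj (tor D) x.1), vsval (vsproj (tor D) x.2)).
  by rewrite !vsprojK//; case: (x).
have -> : gbr f x = - (gbr x f) by rewrite (lie_brC gl).
rewrite xE (root_vec_cartan _ _ rf) (lie_brNr gl)// (lie_brZr gl)// (lie_brxx gl).
by rewrite scaler0 oppr0 eqxx.
Qed.

End RootTheory.

(** * Roots, weights and the orbit of the highest root *)

Lemma zspan_common_multiple (V : zmodType) (S : set V) (n : nat) (x : 'I_n -> V) :
  (forall i, exists2 m, (0 < m)%N & x i *+ m \in zspan S) ->
  exists2 N, (0 < N)%N & forall y, y \in zspan (range x) -> y *+ N \in zspan S.
Proof.
move=> h; have /choice[m mP] i : exists m, (0 < m)%N /\ x i *+ m \in zspan S.
  by have [m m0 mS] := h i; exists m.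
exists (\prod_i m i)%N; first by rewrite prodn_gt0// => i; case: (mP i).
apply: zspan_ind => [|y z Py Pz|_ [i _ <-]]; first by rewrite mul0rn rpred0.
  by rewrite mulrnBl rpredB.
by rewrite (bigD1 i)//= mulrnA rpredMn//; case: (mP i).
Qed.

Section Lattices.
Variables (R : realType) (D : lie_data R).
Hypothesis hD : simple_lie_data D.

Local Notation tt := (Defs.tt D).
Implicit Types (r s H x : tt).

(** [linfun] computes only for functions packed as linear maps. *)
Lemma reflectionE r H : reflection r H = H - dot H (coroot r) *: r.
Proof.
pose f H' := H' - dot H' (coroot r) *: r.
have fl : linear f.
  move=> a x y; rewrite /f dotDl dotZl scalerDl scalerBr scalerA opprD.
  by rewrite addrACA.
pose fL : {linear tt -> tt} := HB.pack f (GRing.isLinear.Build _ _ _ _ f fl).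
exact: (lfunE fL).
Qed.

Lemma reflectionK r : r != 0 -> involutive (reflection r).
Proof.
move=> r0 H; rewrite !reflectionE dotBl dotZl coroot_self//.
set a := dot H _; rewrite -addrA -opprD -scalerDl.
have -> : a + (a - a * 2) = 0 by ring.
by rewrite scale0r subr0.
Qed.

Lemma dot_reflection r x H : r != 0 -> dot (reflection r x) (reflection r H) = dot x H.
Proof.
move=> r0; rewrite !reflectionE /coroot !(dotBl, dotBr, dotZl, dotZr) (dotC r H).
by field; rewrite dot_eq0.
Qed.

Lemma is_root_reflection r s : is_root r -> is_root s -> is_root (reflection r s).
Proof. by move=> rr rs; rewrite reflectionE; exact: root_reflection. Qed.

Lemma coroot_reflection r s : r != 0 ->
  coroot (reflection r s) = coroot s - dot r (coroot s) *: coroot r.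
Proof.
move=> r0; rewrite {1}/coroot dot_reflection// reflectionE scalerBr -/(coroot s).
congr (_ - _); rewrite /coroot !dotZr !scalerA (dotC r s); congr (_ *: _).
by ring.
Qed.

Lemma root_neq0 r : is_root r -> r != 0.
Proof. by case=> /eqP. Qed.

Lemma weyl_root theta r : weyl theta -> is_root r -> is_root (theta r).
Proof.
move=> wt; elim: wt r => [|s th rs wth IH] r rr; first by rewrite id_lfunE.
by rewrite comp_lfunE; apply: is_root_reflection => //; exact: IH.
Qed.

Lemma sr_neq0 (i : 'I_(rank D)) : sr i != 0.
Proof. exact/root_neq0/(sroot_root hD). Qed.

Lemma sr_free (c : 'I_(rank D) -> R) :
  \sum_i c i *: sr i = 0 -> forall i, c i = 0.
Proof.
move=> c0; have /freeP := basis_free (sroot_basis hD); apply.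
by rewrite -[RHS]c0; apply: eq_bigr => i _; rewrite /sr (tnth_nth 0).
Qed.

Lemma sr_span x : exists c : 'I_(rank D) -> R, x = \sum_i c i *: sr i.
Proof.
have := memvf x; rewrite -(span_basis (sroot_basis hD)) => /coord_span xE.
exists (fun i => coord (sroot D) i x); rewrite [LHS]xE.
by apply: eq_bigr => i _; rewrite /sr (tnth_nth 0).
Qed.

Lemma sr_nondeg x : (forall i, dot x (sr i) = 0) -> x = 0.
Proof.
move=> x0; apply: dot_nondeg => H; have [c ->] := sr_span H.
by rewrite dotC dot_suml big1// => i _; rewrite dotZl dotC x0 mulr0.
Qed.

Lemma dot_coroot0 x r : r != 0 -> (dot x (coroot r) == 0) = (dot x r == 0).
Proof.
move=> r0; rewrite /coroot dotZr mulf_eq0 mulf_eq0 invr_eq0 dot_eq0 (negPf r0).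
by rewrite pnatr_eq0.
Qed.

Lemma dot_coroot_gt0 x r : r != 0 -> (0 < dot x (coroot r)) = (0 < dot x r).
Proof. by move=> r0; rewrite /coroot dotZr pmulr_rgt0// divr_gt0// dot_gt0. Qed.

Lemma coroot_nondeg x : (forall i, dot x (coroot (sr i)) = 0) -> x = 0.
Proof.
move=> x0; apply: sr_nondeg => i; apply/eqP.
by rewrite -dot_coroot0 ?sr_neq0// x0.
Qed.

Lemma weyl_reflr r theta : is_root r -> weyl theta ->
  weyl (theta \o reflection r)%VF.
Proof.
move=> rr; elim=> [|s th rs wth IH]; last by rewrite -comp_lfunA; exact: weyl_refl.
rewrite comp_lfun1l -[reflection r]comp_lfun1r.
by apply: weyl_refl => //; exact: weyl_one.
Qed.

Definition simple_coroots : set tt := range (fun i => coroot (sr i)).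

(** Both halves propagate along simple reflections, hence one induction. The first one serves the
    orbit of the highest root, the second the integrality of weights on all coroots. *)
Definition conj_simple r : Prop :=
  (exists i theta, weyl theta /\ sr i = theta r) /\
  coroot r \in zspan simple_coroots.

Lemma conj_simple_sr i : conj_simple (sr i).
Proof.
split; first by exists i, \1%VF; split; [exact: weyl_one|rewrite id_lfunE].
by apply: zspan_gen; exists i.
Qed.

Lemma conj_simple_reflection i r : is_root r -> conj_simple r ->
  conj_simple (reflection (sr i) r).
Proof.
move=> rr [[j [th [wth rE]]] cr]; have ri := sroot_root hD i; split.
  exists j, (th \o reflection (sr i))%VF; split; first exact: weyl_reflr.
  by rewrite comp_lfunE reflectionK ?sr_neq0.
rewrite coroot_reflection ?sr_neq0//.
have [m ->] := root_coroot_int hD rr ri.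
apply: rpredB => //; rewrite scaler_int; apply: rpredMz; apply: zspan_gen; by exists i.
Qed.

(* Induction on the height: if the reflection in a simple root makes a positive
   root negative, this root is a multiple of that simple root. *)
Lemma conj_simple_nonneg r : is_root r -> nonneg r -> conj_simple r.
Proof.
move=> rr [c rE]; have [n] := ubnP (\sum_i c i)%N.
elim: n => // n IH in r c rr rE *; rewrite ltnS => cn.
(* Since <r, r> > 0 and r has nonnegative coordinates, some simple root pairs positively with r. *)
have [i di] : exists i, 0 < dot r (sr i).
  apply: contrapT => /forallNP neg; have := dot_gt0 (root_neq0 rr).
  apply/negP; rewrite -leNgt {2}rE dotC dot_suml; apply: sumr_le0 => i _.
  rewrite -[sr i *+ _]scaler_nat dotZl dotC mulr_ge0_le0//.
  by have /negP := neg i; rewrite -leNgt.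
have ri := sroot_root hD i; have i0 := sr_neq0 i.
have [m mE] := root_coroot_int hD ri rr.
have m0 : 0 < m by rewrite -(ltr0z R) -mE dot_coroot_gt0.
have rr' := is_root_reflection ri rr.
have r'E : reflection (sr i) r = \sum_j ((c j)%:R - (j == i)%:R * m%:~R) *: sr j.
  rewrite reflectionE mE {1}rE.
  under [RHS]eq_bigr do rewrite scalerBl.
  rewrite sumrB; congr (_ - _); first by apply: eq_bigr => j _; rewrite scaler_nat.
  rewrite (bigD1 i)//= eqxx mul1r big1 ?addr0// => j /negPf ->.
  by rewrite mul0r scale0r.
have uniq (a b : 'I_(rank D) -> R) : \sum_j a j *: sr j = \sum_j b j *: sr j ->
    forall j, a j = b j.
  move=> ab j; apply/eqP; rewrite -subr_eq0; apply/eqP; move: j.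
  by apply: sr_free; under eq_bigr do rewrite scalerBl; rewrite sumrB ab subrr.
have [[d dE]|[d dE]] := root_sign hD rr'.
  suff : conj_simple (reflection (sr i) r).
    by move/(conj_simple_reflection i rr'); rewrite reflectionK.
  apply: (IH _ d) => //; apply: leq_trans cn.
  have cd : forall j, (c j)%:R - (j == i)%:R * m%:~R = (d j)%:R :> R.
    by apply: uniq; rewrite -r'E dE; apply: eq_bigr => j _; rewrite scaler_nat.
  rewrite (bigD1 i)//= [ltnRHS](bigD1 i)//= -addSn leq_add//; last first.
    apply: leq_sum => j /negPf ji; rewrite -(ler_nat R) -cd ji mul0r subr0//.
  rewrite -(ltr_nat R) -cd eqxx mul1r ltrBlDr ltrDl ltr0z//.
have cd : forall j, (j == i)%:R * m%:~R - (c j)%:R = (d j)%:R :> R.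
  apply: uniq; transitivity (- reflection (sr i) r).
    by rewrite r'E -sumrN; apply: eq_bigr => j _; rewrite -scaleNr opprB.
  by rewrite dE; apply: eq_bigr => j _; rewrite scaler_nat.
(* Coordinates other than i are unchanged by the reflection, so here they are both nonnegative and
   nonpositive. *)
have {}rE : r = sr i *+ c i.
  rewrite {1}rE (bigD1 i)//= big1 ?addr0// => j /negPf ji.
  have := cd j; rewrite ji mul0r sub0r => /eqP; rewrite eq_sym.
  rewrite -subr_eq0 opprK -natrD pnatr_eq0 addn_eq0 => /andP[_ /eqP ->].
  by rewrite mulr0n.
have ci0 : (c i)%:R != 0 :> R.
  apply: contraTneq (root_neq0 rr) => c0.
  by rewrite rE -[sr i *+ _]scaler_nat c0 scale0r eqxx.
(* For r = c sr_i the integer <sr_i, H_r> is 2/c, so c is 1 or 2, and 2 is excluded by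
   [root_double]. *)
have [q qE] := root_coroot_int hD rr ri.
have qc : (q * (c i)%:Z = 2)%R.
  apply: (@intr_inj R); rewrite intrM -qE rE /coroot -[sr i *+ _]scaler_nat.
  by rewrite !(dotZl, dotZr); field; rewrite dot_eq0 i0.
have c12 : (c i = 1 \/ c i = 2)%N.
  have {}qc : (absz q * c i = 2)%N by move/(congr1 absz): qc; rewrite abszM.
  have : (c i <= 2)%N by rewrite dvdn_leq// -qc dvdn_mull.
  by case: (c i) qc => [|[|[|]]]//; [rewrite muln0|left|right].
case: c12 => ci; rewrite ci in rE; first by rewrite rE mulr1n; exact: conj_simple_sr.
by case: (root_double hD ri); rewrite -rE.
Qed.

Lemma coroot_in r : is_root r -> coroot r \in zspan simple_coroots.
Proof.
move=> rr; have [/(conj_simple_nonneg rr)[]//|nr] := root_sign hD rr.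
have [_] := conj_simple_nonneg (is_rootN hD rr) nr.
by rewrite corootN rpredN.
Qed.

(** The [xget] in [fweight] needs existence: pairing with the simple coroots is an injective map
    between spaces of dimension [rank D], hence onto. *)
Lemma fweightE i j : dot (@fweight R D i) (coroot (sr j)) = (i == j)%:R.
Proof.
move: j; apply: (@xgetPex _ 0
  [set w : tt | forall j, dot w (coroot (sr j)) = (i == j)%:R]).
pose f x : 'rV[R]_(rank D) := \row_j dot x (coroot (sr j)).
have fl : linear f.
  by move=> a x y; apply/rowP => j; rewrite !mxE dotDl dotZl.
pose fL : {linear tt -> 'rV[R]_(rank D)} :=
  HB.pack f (GRing.isLinear.Build _ _ _ _ f fl).
have fE x : linfun fL x = f x by exact: lfunE.
have ker0 : lker (linfun fL) = 0%VS.
  apply/eqP; rewrite -subv0; apply/subvP => x; rewrite memv_ker fE => /eqP/rowP fx.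
  rewrite memv0; apply/eqP/coroot_nondeg => j.
  by have := fx j; rewrite !mxE.
have := limg_ker_dim (linfun fL) fullv; rewrite ker0 capv0 dimv0 add0n => dimf.
have full : limg (linfun fL) = fullv.
  apply/eqP; rewrite eqEdim subvf/= dimf dimvf dim_matrix mul1r.
  by rewrite (size_basis (sroot_basis hD)).
have /memv_imgP[x _ dx] : delta_mx 0 i \in limg (linfun fL) by rewrite full memvf.
exists x => j; have /rowP/(_ j) := dx; rewrite fE !mxE eqxx/= => <-.
by rewrite eq_sym.
Qed.

Lemma fweight_span x : x = \sum_i dot x (coroot (sr i)) *: fweight i.
Proof.
apply/eqP; rewrite -subr_eq0; apply/eqP/coroot_nondeg => j.
rewrite dotBl dot_suml (bigD1 j)//= dotZl fweightE eqxx mulr1 big1 ?addr0 ?subrr//.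
by move=> i /negPf ij; rewrite dotZl fweightE ij mulr0.
Qed.

Lemma coroot_span x : x = \sum_i dot (@fweight R D i) x *: coroot (sr i).
Proof.
apply/eqP; rewrite -subr_eq0; apply/eqP/dot_nondeg => H.
rewrite dotC (fweight_span H) dot_suml big1// => i _.
rewrite dotZl dotBr [dot _ (\sum_j _)]dotC dot_suml (bigD1 i)//= dotZl.
rewrite (dotC (coroot (sr i)) (fweight i)) (fweightE i i) eqxx mulr1.
rewrite big1 ?addr0 ?subrr ?mulr0//.
by move=> j /negPf ij; rewrite dotZl (dotC (coroot (sr j))) fweightE eq_sym ij mulr0.
Qed.

Lemma weight_latticeP x :
  (forall i, exists m : int, dot x (coroot (sr i)) = m%:~R) <->
  x \in zspan (range (@fweight R D)).
Proof.
split=> [/choice[m mE]|xW i].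
  rewrite (fweight_span x); apply: rpred_sum => i _; rewrite mE scaler_int.
  by apply: rpredMz; exact: fweight_in.
move: x xW; apply: zspan_ind => [|x y [m mE] [n nE]|_ [j _ <-]].
- by exists 0; rewrite dot0l.
- by exists (m - n); rewrite dotBl mE nE rmorphB.
- by exists (j == i); rewrite fweightE; case: eqP.
Qed.

Lemma weight_coroot_int (k : weight D) r : is_root r ->
  exists m : int, dot (val k) (coroot r) = m%:~R.
Proof.
move=> /coroot_in; move: (coroot r).
apply: zspan_ind => [|x y [m mE] [n nE]|_ [i _ <-]].
- by exists 0; rewrite dot0r.
- by exists (m - n); rewrite dotBr mE nE rmorphB.
- by move: i; apply/weight_latticeP; exact: valP.
Qed.

Lemma root_weight r : is_root r -> r \in zspan (range (@fweight R D)).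
Proof.
move=> rr; apply/weight_latticeP => i.
by apply: root_coroot_int => //; exact: sroot_root.
Qed.

Lemma Rh_root r : Rh D r -> is_root r.
Proof. by move=> [th wth ->]; apply: weyl_root => //; exact: rplus_root. Qed.

Lemma Rh_reflection s r : is_root s -> Rh D r -> Rh D (reflection s r).
Proof.
move=> rs [th wth ->]; exists (reflection s \o th)%VF; first exact: weyl_refl.
by rewrite comp_lfunE.
Qed.

Lemma Rh_rplus : Rh D (rplus D).
Proof. by exists \1%VF; [exact: weyl_one|rewrite id_lfunE]. Qed.

Lemma rplus_coroot : coroot (rplus D) = rplus D.
Proof. by rewrite /coroot (rplus_norm hD) divff ?scale1r// pnatr_eq0. Qed.

Lemma nc_nat (l : nat) : exists2 n, (0 < n)%N & nc D l = n%:R.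
Proof.
have [m mE] := weight_coroot_int (rho D) (rplus_root hD).
have rho_sr i : dot (val (rho D)) (coroot (sr i)) = 1.
  rewrite raddf_sum/= dot_suml (bigD1 i)//= fweightE eqxx big1 ?addr0//.
  by move=> j /negPf ji; rewrite fweightE ji.
(* Comparing the highest root with its own negative writes 2 r_+ as a nonnegative combination of
   simple roots, each of which pairs positively with rho; so m >= 0. *)
have [c cE] := rplus_highest hD (is_rootN hD (rplus_root hD)).
have m0 : 0 <= m.
  rewrite -(ler0z R) -mE rplus_coroot -(@pmulr_rge0 _ 2)// -dotZr.
  rewrite scaler_nat mulr2n -{2}[rplus D]opprK cE dotC dot_suml.
  apply: sumr_ge0 => i _; rewrite -[sr i *+ _]scaler_nat dotZl mulr_ge0// dotC.
  by rewrite ltW// -dot_coroot_gt0 ?sr_neq0// rho_sr.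
exists (1 + absz m + l)%N => //.
by rewrite /nc /dual_coxeter mE !natrD natr_absz (ger0_norm m0).
Qed.

Lemma sr_coord_uniq (a b : 'I_(rank D) -> R) :
  \sum_i a i *: sr i = \sum_i b i *: sr i -> forall i, a i = b i.
Proof.
move=> ab i; apply/eqP; rewrite -subr_eq0; apply/eqP; move: i.
by apply: sr_free; under eq_bigr do rewrite scalerBl; rewrite sumrB ab subrr.
Qed.

(** Each r_+ - sr_i has natural coordinates, so the i-th coordinate of r_+ is at least 1. *)
Lemma rplus_coord_gt0 (a : 'I_(rank D) -> R) :
  rplus D = \sum_i a i *: sr i -> forall i, 0 < a i.
Proof.
move=> aE i; have [d dE] := rplus_highest hD (sroot_root hD i).
suff -> : a i = (i == i)%:R + (d i)%:R by rewrite eqxx ltr_wpDr.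
apply: (sr_coord_uniq (b := fun j => (i == j)%:R + (d j)%:R)); rewrite -aE.
under eq_bigr do rewrite scalerDl; rewrite big_split/=.
have -> : \sum_j (d j)%:R *: sr j = rplus D - sr i.
  by rewrite dE; apply: eq_bigr => j _; rewrite scaler_nat.
rewrite (bigD1 i)//= eqxx scale1r big1 ?addr0 => [|j /negPf ij].
  by rewrite addrC subrK.
by rewrite eq_sym ij scale0r.
Qed.

(* Otherwise the part of the highest root supported on the simple roots
   orthogonal to its orbit would be orthogonal to itself. *)
Lemma Rh_sr i : exists2 r, Rh D r & dot r (sr i) != 0.
Proof.
apply: contrapT => ni.
have perp r : Rh D r -> dot r (sr i) = 0.
  by move=> Rr; apply: contrapT => /eqP ri; apply: ni; exists r.
have [a aE] := sr_span (rplus D); have a_gt0 := rplus_coord_gt0 aE.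
pose B j := `[< forall r, Rh D r -> dot r (sr j) = 0 >].
pose y := \sum_(j | B j) a j *: sr j.
have yR r : Rh D r -> dot r y = 0.
  move=> Rr; rewrite dotC dot_suml big1// => j /asboolP Bj.
  by rewrite dotZl dotC Bj// mulr0.
(* Reflecting r in sr_j stays in the orbit and changes r by a nonzero multiple of sr_j; both roots
   are orthogonal to y. *)
have yA j : ~~ B j -> dot (sr j) y = 0.
  move=> /asboolPn/existsNP[r /not_implyP[Rr /eqP rj]].
  have := yR _ (Rh_reflection (sroot_root hD j) Rr).
  rewrite reflectionE dotBl yR// sub0r dotZl => /eqP.
  by rewrite oppr_eq0 mulf_eq0 dot_coroot0 ?sr_neq0// (negPf rj) => /eqP.
have yy : dot y y = 0.
  have := yR _ Rh_rplus; rewrite {1}aE (bigID B)/= -/y dotDl => <-.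
  rewrite [X in _ + X]dot_suml [X in _ + X]big1 ?addr0// => j Bj.
  by rewrite dotZl yA// mulr0.
have /eqP := yy; rewrite dot_eq0 /y big_mkcond => /eqP y0.
suff : (if B i then a i else 0) = 0.
  by case: ifPn => [_ ai|/asboolPn//]; have := a_gt0 i; rewrite ai ltxx.
apply: (sr_free (c := fun i => if B i then a i else 0)); apply: etrans y0.
by apply: eq_bigr => j _; case: ifP; rewrite ?scale0r.
Qed.

(** The difference of r and its reflection in sr_i is an integer multiple of sr_i, nonzero for the r
    of [Rh_sr]. *)
Lemma sr_mul_Ra i : exists2 m : nat, (0 < m)%N & sr i *+ m \in zspan (Rh D).
Proof.
have [r Rr ri] := Rh_sr i; have si := sroot_root hD i.
have [m mE] := root_coroot_int hD si (Rh_root Rr).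
have m0 : m != 0 by rewrite -(intr_eq0 R) -mE dot_coroot0 ?sr_neq0.
exists (absz m); first by rewrite absz_gt0.
have mi : sr i *~ m \in zspan (Rh D).
  rewrite -scaler_int -mE -[_ *: _](subKr r) -reflectionE.
  by apply: rpredB; apply: zspan_gen => //; exact: Rh_reflection.
case: (intP m) mi => [|n|n]; rewrite ?mulr0z//.
by rewrite mulrNz rpredN abszN.
Qed.

Lemma root_lattice_sr r : is_root r -> r \in zspan (range (@sr R D)).
Proof.
have pos s : nonneg s -> s \in zspan (range (@sr R D)).
  by move=> [c ->]; apply: rpred_sum => i _; apply: rpredMn; apply: zspan_gen; exists i.
by move=> /(root_sign hD)[/pos//|/pos]; rewrite rpredN.
Qed.

(** The multiplier is the determinant of the Cartan matrix, and the adjugate gives the integral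
    coordinates. A kernel vector would be a combination of simple roots orthogonal to all simple
    coroots. *)
Lemma fweight_mul_sr i :
  exists2 m : nat, (0 < m)%N & fweight i *+ m \in zspan (range (@sr R D)).
Proof.
have /choice[A0 A0E] i' : exists a : 'I_(rank D) -> int,
    forall j, dot (sr i') (coroot (sr j)) = (a j)%:~R.
  have /choice[a aE] j : exists m : int, dot (sr i') (coroot (sr j)) = m%:~R.
    by apply: root_coroot_int => //; exact: sroot_root.
  by exists a.
pose A : 'M[int]_(rank D) := \matrix_(k, j) A0 k j.
have detA : \det A != 0.
  apply/negP => /eqP dA.
  have /eqP/det0P[v v0 vA] : \det (map_mx intr A : 'M[R]_(rank D)) = 0.
    by rewrite det_map_mx dA.
  case/eqP: v0; apply/rowP => k; rewrite [RHS]mxE; move: k.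
  apply: sr_free; apply: coroot_nondeg => j; rewrite dot_suml.
  have /rowP/(_ j) := vA; rewrite !mxE => vAj; apply: etrans vAj.
  apply: eq_bigr => k _.
  by rewrite dotZl A0E !mxE.
exists (absz (\det A)); first by rewrite absz_gt0.
have mi : fweight i *~ (\det A) \in zspan (range (@sr R D)).
  have -> : fweight i *~ (\det A) = \sum_k sr k *~ (\adj A) i k.
    apply/eqP; rewrite -subr_eq0; apply/eqP/coroot_nondeg => j.
    rewrite dotBl dot_suml -[fweight i *~ _]scaler_int dotZl fweightE.
    have /matrixP/(_ i j) := mul_adj_mx A; rewrite !mxE => /(congr1 intr) adjA.
    rewrite -[_%:~R * _](_ : (\det A *+ (i == j))%:~R = _); last first.
      by case: eqP => _; rewrite ?mulr1n ?mulr1// mulr0n mulr0.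
    rewrite -adjA rmorph_sum/= -sumrB big1// => k _.
    by rewrite -[sr k *~ _]scaler_int dotZl A0E intrM [A k j]mxE subrr.
  by apply: rpred_sum => k _; apply: rpredMz; apply: zspan_gen; exists k.
case: (intP (\det A)) mi => [|n|n]; rewrite ?mulr0z//.
by rewrite mulrNz rpredN abszN.
Qed.

(** The exponents multiply along the chain from W to R, to R_a, to n_c R_a. *)
Lemma ncRh_full l : exists2 N, (0 < N)%N & forall x,
  x \in zspan (range (@fweight R D)) -> x *+ N \in zspan (@ncRh R D l).
Proof.
have [N1 N1_gt0 N1P] := zspan_common_multiple sr_mul_Ra.
have [N2 N2_gt0 N2P] := zspan_common_multiple fweight_mul_sr.
have [n n_gt0 nE] := nc_nat l.
exists (N2 * N1 * n)%N; first by rewrite !muln_gt0 N2_gt0 N1_gt0.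
move=> x /N2P/N1P; rewrite !mulrnA; move: (x *+ N2 *+ N1).
apply: zspan_ind => [|y z Py Pz|r Rr]; first by rewrite mul0rn rpred0.
  by rewrite mulrnBl rpredB.
by apply: zspan_gen; exists r => //; rewrite nE scaler_nat.
Qed.

(** One of r_+ and -r_+ is conjugate to a simple root; in the second case the reflection in r_+
    corrects the sign. *)
Lemma exists_Rh_sr : exists i, Rh D (sr i).
Proof.
have rr := rplus_root hD; have r0 := root_neq0 rr.
have [/(conj_simple_nonneg rr)|/(conj_simple_nonneg (is_rootN hD rr))] :=
    root_sign hD rr => -[[i [th [wth iE]]] _]; exists i.
  by exists th.
exists (th \o reflection (rplus D))%VF; first exact: weyl_reflr.
rewrite comp_lfunE reflectionE coroot_self// (_ : _ - _ = - rplus D)//.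
by rewrite scaler_nat mulr2n opprD addrA subrr sub0r.
Qed.

(** For a simple bond, reflecting sr_i in sr_j and then in sr_i yields sr_j. *)
Lemma Rh_adjacent i j : dot (sr i) (coroot (sr j)) = -1 ->
  dot (sr j) (coroot (sr i)) = -1 -> Rh D (sr i) -> Rh D (sr j).
Proof.
move=> ij ji Ri; have ri := sroot_root hD i.
have := Rh_reflection ri (Rh_reflection (sroot_root hD j) Ri).
rewrite [reflection (sr j) _]reflectionE ij reflectionE dotBl dotZl ji.
rewrite coroot_self ?sr_neq0//.
rewrite !scaleN1r !opprK mulN1r opprK (_ : 2 - 1 = 1); last by ring.
by rewrite scale1r addrC addKr.
Qed.

Lemma type_ADE_Rh : type_ADE D -> forall i, Rh D (sr i).
Proof.
(* The second premise is connectedness of the diagram: a property inherited along edges passes from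
   any node to any other. *)
have main (e : rel nat) : has_diagram D e ->
    (forall Q : nat -> Prop, (forall a b, (a < rank D)%N -> (b < rank D)%N ->
       a != b -> e a b -> e b a -> Q a -> Q b) ->
     forall a b, (a < rank D)%N -> (b < rank D)%N -> Q a -> Q b) ->
    forall i, Rh D (sr i).
  move=> [s sE] conn i.
  pose Q (a : nat) := exists2 k : 'I_(rank D), a = k :> nat & Rh D (sr (s k)).
  have [j Rj] := exists_Rh_sr.
  have [//||||k /val_inj <-] := conn Q _ ((s^-1)%g j) ((s^-1)%g i);
    last by rewrite permKV.
  - move=> a b al bl ab eab eba [k ak Rk]; exists (Ordinal bl) => //.
    have kE : k = Ordinal al by apply: val_inj; rewrite /= -ak.
    move: Rk; rewrite kE; apply: Rh_adjacent; rewrite sE -(inj_eq val_inj)/=.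
      by rewrite (negPf ab) eab.
    by rewrite eq_sym (negPf ab) eba.
  - exact: ltn_ord.
  - exact: ltn_ord.
  - by exists ((s^-1)%g j) => //; rewrite permKV.
have path n (Q : nat -> Prop) :
    (forall k, (k.+1 < n)%N -> Q k <-> Q k.+1) ->
    forall a, (a < n)%N -> Q 0%N <-> Q a.
  move=> Qk; elim=> // a IH an; rewrite IH; last exact: ltnW.
  exact: Qk.
have fork (b : nat) : (b < (rank D).-1)%N -> has_diagram D (dynkin_fork (rank D) b) ->
    forall i, Rh D (sr i).
  move=> bn hd; apply: (main _ hd) => Q Qe.
  have Q0 a : (a < (rank D).-1)%N -> Q 0%N <-> Q a.
    apply: path => k kn; have k1n := ltnW kn.
    have kr := leq_trans kn (leq_pred _); have k1r := leq_trans k1n (leq_pred _).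
    have kk : k != k.+1 by rewrite neq_ltn ltnSn.
    have e1 : dynkin_fork (rank D) b k k.+1.
      by rewrite /dynkin_fork kn k1n /dynkin_path eqxx.
    have e2 : dynkin_fork (rank D) b k.+1 k.
      by rewrite /dynkin_fork kn k1n /dynkin_path eqxx orbT.
    by split; apply: Qe; rewrite // eq_sym.
  have Q0' a : (a < rank D)%N -> Q 0%N <-> Q a.
    move=> an; have [/Q0//|] := ltnP a (rank D).-1 => na.
    have -> : a = (rank D).-1.
      apply/eqP; rewrite eqn_leq na andbT -ltnS prednK//.
      by case: (rank D) an.
    have nr : ((rank D).-1 < rank D)%N by rewrite prednK//; case: (rank D) an.
    have br := ltn_trans bn nr.
    have bb : b != (rank D).-1 by rewrite neq_ltn bn.
    have e1 : dynkin_fork (rank D) b b (rank D).-1.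
      by rewrite /dynkin_fork ltnn andbF !eqxx orbT.
    have e2 : dynkin_fork (rank D) b (rank D).-1 b.
      by rewrite /dynkin_fork ltnn !eqxx.
    by rewrite (Q0 b)//; split; apply: Qe; rewrite // eq_sym.
  by move=> a a' /Q0' h /Q0' h'; rewrite -h -h'.
case=> [hd|[r4 hd]|[r678 hd]].
- apply: (main _ hd) => Q Qe.
  have Q0 : forall a, (a < rank D)%N -> Q 0%N <-> Q a.
    apply: path => k kn; have k1n := ltnW kn.
    have kk : k != k.+1 by rewrite neq_ltn ltnSn.
    have e1 : dynkin_path k k.+1 by rewrite /dynkin_path eqxx.
    have e2 : dynkin_path k.+1 k by rewrite /dynkin_path eqxx orbT.
    by split; apply: Qe; rewrite // eq_sym.
  by move=> a a' /Q0 h /Q0 h'; rewrite -h -h'.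
- by apply: fork hd; lia.
- by apply: fork hd; move: r678; rewrite !inE => /or3P[] /eqP ->.
Qed.

Lemma type_ADE_root_lattice r : type_ADE D -> is_root r -> r \in zspan (Rh D).
Proof.
move=> /type_ADE_Rh Rsr /root_lattice_sr; move: r.
apply: zspan_ind => [|x y|_ [i _ <-]]; [exact: rpred0|exact: rpredB|].
exact/zspan_gen/Rsr.
Qed.

End Lattices.

(** * Characters of the weight lattice *)

Section Expi.
Variable R : realType.
Implicit Types x y : R.

Lemma expi0 : expi (0 : R) = 1. Proof. by rewrite /expi cos0 sin0. Qed.

Lemma expiD x y : expi (x + y) = expi x * expi y.
Proof.
apply/eqP; rewrite eq_complex /expi/= sinD cosD eqxx/=.
by rewrite addrC [cos x * _]mulrC [sin x * _]mulrC [cos y * _]mulrC.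
Qed.

Lemma expi_neq0 x : expi x != 0.
Proof.
apply/negP => /eqP x0; have := expiD x (- x); rewrite x0 mul0r subrr expi0.
by move/eqP; rewrite oner_eq0.
Qed.

Lemma expiN x : expi (- x) = (expi x)^-1.
Proof.
by apply: (mulIf (expi_neq0 x)); rewrite -expiD addNr expi0 mulVf ?expi_neq0.
Qed.

Lemma expiMn x n : expi (x * n%:R) = expi x ^+ n.
Proof.
elim: n => [|n IH]; first by rewrite mulr0 expi0.
by rewrite -natr1 mulrDr mulr1 expiD IH exprSr.
Qed.

Lemma expi_2piz (m : int) : expi (2 * trigo.pi * m%:~R : R) = 1.
Proof.
have e1 : expi (2 * trigo.pi : R) = 1.
  by rewrite mulr_natl /expi cos2pi sin2pi.
case: (intP m) => [|n|n]; first by rewrite mulr0 expi0.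
  by rewrite -pmulrn expiMn e1 expr1n.
by rewrite mulrNz mulrN expiN -pmulrn expiMn e1 expr1n invr1.
Qed.

(** Reduce x to t in [0, 2 pi). The sine does not vanish on (0, pi) or (pi, 2 pi), and the cosine of
    pi is -1, so t = 0. *)
Lemma expi_eq1 x : expi x = 1 -> exists m : int, x = 2 * trigo.pi * m%:~R.
Proof.
move=> x1; have p0 := @pi_gt0 R; have pp : 0 < 2 * trigo.pi :> R by rewrite mulr_gt0.
set m := Num.floor (x / (2 * trigo.pi)); exists m.
pose t := x - 2 * trigo.pi * m%:~R.
have t1 : expi t = 1 by rewrite /t expiD x1 mul1r expiN expi_2piz invr1.
have /andP[lo hi] := floor_itv (x / (2 * trigo.pi)); rewrite -/m in lo hi.
have t0 : 0 <= t by rewrite subr_ge0 mulrC -ler_pdivlMr.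
have t2 : t < 2 * trigo.pi.
  move: hi; rewrite ltr_pdivrMr// intrD mulrDl mul1r => hi.
  by rewrite ltrBlDr addrC [2 * _ * _]mulrC.
have [ct st] : cos t = 1 /\ sin t = 0 by case: t1.
apply/eqP; rewrite -subr_eq0 -/t; apply/negPn/negP => tn0.
have t_gt0 : 0 < t by rewrite lt_def tn0.
have [tp|tp|tp] := ltgtP t trigo.pi.
- by have := @sin_gt0_pi R t; rewrite t_gt0 tp st ltxx => /(_ isT).
- have := @sin_gt0_pi R (t - trigo.pi).
  have := sinDpi (t - trigo.pi); rewrite subrK st => /eqP.
  rewrite eq_sym oppr_eq0 => /eqP ->; rewrite subr_gt0 tp ltrBlDr -mulr2n -mulr_natl t2.
  by rewrite ltxx => /(_ isT).
- have := @cospi R; rewrite -tp ct => /eqP.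
  by rewrite -addr_eq0 -[1 + 1]/(2%:R) pnatr_eq0.
Qed.

End Expi.

Section Torus.
Variables (R : realType) (D : lie_data R).
Hypothesis hD : simple_lie_data D.

Local Notation tt := (Defs.tt D).
Local Notation twopi := (2 * trigo.pi : R).
Implicit Types (H x : tt) (k j : weight D) (u v : torus D).

Lemma twopi_gt0 : 0 < twopi. Proof. by rewrite mulr_gt0// pi_gt0. Qed.

Definition echar k u : R[i] := expi (dot (val k) (logT u)).

(** Two logarithms differ by 2 pi times a sum of coroots, on which weights are integral. *)
Lemma echar_expT k H : echar k (expT H) = expi (dot (val k) H).
Proof.
rewrite /echar -[logT (expT H)](subrK H) dotDr expiD.
suff -> : expi (dot (val k) (logT (expT H) - H)) = 1 by rewrite mul1r.
have : logT (expT H) - H \in zspan [set twopi *: coroot r | r in @is_root R D].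
  by rewrite Quotient.idealrBE; apply/eqP; rewrite /logT reprK.
suff h x : x \in zspan [set twopi *: coroot r | r in @is_root R D] ->
    exists m : int, dot (val k) x = twopi * m%:~R.
  by move=> /h[m ->]; rewrite expi_2piz.
move: x; apply: zspan_ind => [|x y [m mE] [n nE]|_ [r rr <-]].
- by exists 0; rewrite dot0r mulr0.
- by exists (m - n); rewrite dotBr mE nE rmorphB mulrBr.
- by have [m mE] := weight_coroot_int hD k rr; exists m; rewrite dotZr mE.
Qed.

Lemma expT_logT u : expT (logT u) = u. Proof. exact: reprK. Qed.

Lemma expTD H x : expT (H + x) = expT H + expT x.
Proof. exact: (raddfD (\pi_(torus D)%qT)). Qed.

Lemma echarDl k j u : echar (k + j) u = echar k u * echar j u.
Proof. by rewrite /echar raddfD/= dotDl expiD. Qed.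

Lemma echarDr k u v : echar k (u + v) = echar k u * echar k v.
Proof. by rewrite -[u]expT_logT -[v]expT_logT -expTD !echar_expT dotDr expiD. Qed.

Lemma echar0l u : echar 0 u = 1.
Proof. by rewrite /echar raddf0 dot0l expi0. Qed.

Lemma echar_neq0 k u : echar k u != 0. Proof. exact: expi_neq0. Qed.

Lemma echar0r k : echar k 0 = 1.
Proof. by apply: (mulIf (echar_neq0 k 0)); rewrite -echarDr addr0 mul1r. Qed.

Lemma echarNl k u : echar (- k) u = (echar k u)^-1.
Proof. by rewrite /echar raddfN/= dotNl expiN. Qed.

Lemma echarMn k u n : echar (k *+ n) u = echar k u ^+ n.
Proof. by rewrite /echar raddfMn/= -scaler_nat dotZl mulrC expiMn. Qed.

Lemma echar_sum (I : Type) (s : seq I) (f : I -> weight D) u :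
  echar (\sum_(i <- s) f i) u = \prod_(i <- s) echar (f i) u.
Proof. exact: (big_morph (echar^~ u) (fun k j => echarDl k j u) (echar0l u)). Qed.

Lemma weight_sum k : exists c : 'I_(rank D) -> int, k = \sum_i fw i *~ c i.
Proof.
have /weight_latticeP : val k \in zspan (range (@fweight R D)) by exact: valP.
move=> /(_ hD)/choice[c cE]; exists c; apply: val_inj.
rewrite [LHS](fweight_span hD) raddf_sum; apply: eq_bigr => i _.
by rewrite raddfMz cE scaler_int.
Qed.

(** The pairings <w_i, log u> are the coordinates of log u in the simple coroots; if all lie in 2 pi
    Z, then u is trivial. *)
Lemma echar_fw_inj u v : (forall i, echar (fw i) u = echar (fw i) v) -> u = v.
Proof.
move=> uv; apply/eqP; rewrite -subr_eq0; apply/eqP.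
have {}uv i : echar (fw i) (u - v) = 1.
  apply: (mulIf (echar_neq0 (fw i) v)); rewrite -echarDr subrK mul1r; exact: uv.
move: (u - v) uv => {u v} u u1; rewrite -[LHS]expT_logT.
suff : logT u \in zspan [set twopi *: coroot r | r in @is_root R D].
  move=> lu; have : logT u - 0 \in zspan [set twopi *: coroot r | r in @is_root R D].
    by rewrite subr0.
  by rewrite Quotient.idealrBE => /eqP u0; apply: etrans u0 _; exact: raddf0.
rewrite (coroot_span hD (logT u)); apply: rpred_sum => i _.
have [m mE] := expi_eq1 (u1 i); rewrite mE mulrC -scalerA scaler_int.
by apply: rpredMz; apply: zspan_gen; exists (sr i) => //; exact: sroot_root.
Qed.

Lemma TAP (A : set tt) u : (forall x, A x -> x \in zspan (range (@fweight R D))) ->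
  TA A u <-> forall k, A (val k) -> echar k u = 1.
Proof.
move=> AW; split=> [[H HA ->] k Ak|u1].
  rewrite echar_expT dotZr; have /HA/intrP[m ->] := Ak; exact: expi_2piz.
exists (twopi^-1 *: logT u); last first.
  by rewrite scalerA mulfV ?gt_eqF ?twopi_gt0// scale1r expT_logT.
move=> r Ar; have [m mE] := expi_eq1 (u1 (exist _ r (AW _ Ar)) Ar).
apply/intrP; exists m; rewrite dotZr -[r]/(val (exist _ r (AW _ Ar) : weight D)) mE.
by rewrite mulKf// gt_eqF// twopi_gt0.
Qed.

(** * Torsion points and Fourier inversion *)

Section Points.
Variable N : nat.
Hypothesis N_gt0 : (0 < N)%N.

Local Notation J := {ffun 'I_(rank D) -> 'I_N}.

Definition zetaN : R[i] := expi (twopi / N%:R).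

Let Nr : N%:R != 0 :> R. Proof. by rewrite pnatr_eq0 -lt0n. Qed.

Lemma zetaX n : zetaN ^+ n = expi (twopi * (n%:R / N%:R)).
Proof. by rewrite /zetaN -expiMn; congr expi; ring. Qed.

Lemma zetaX_eq1 n : (zetaN ^+ n == 1) = (N %| n)%N.
Proof.
apply/eqP/dvdnP => [|[q ->]]; last first.
  by rewrite zetaX natrM mulfK// -[q%:R]/((q%:Z)%:~R) expi_2piz.
rewrite zetaX => /expi_eq1[m /(mulfI _) mE]; exists (absz m).
have {}mE : (n%:Z = m * N%:Z)%R.
  apply: (@intr_inj R); rewrite intrM -mE ?mulfVK// gt_eqF// twopi_gt0//.
by move/(congr1 absz): mE; rewrite abszM.
Qed.

Lemma zetaN_prim : N.-primitive_root zetaN.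
Proof.
rewrite /primitive_root_of_unity N_gt0/=; apply/forallP => i.
rewrite unity_rootE zetaX_eq1; apply/eqP; apply/idP/idP => [iN|/eqP ->//].
by rewrite eqn_leq ltn_ord dvdn_leq.
Qed.

(** The N-torsion points of the torus, in coordinates dual to the fundamental weights. *)
Definition torus_pt (a : J) : torus D :=
  expT (\sum_i (twopi * ((a i)%:R / N%:R)) *: coroot (sr i)).

Lemma echar_fw_pt i a : echar (fw i) (torus_pt a) = zetaN ^+ a i.
Proof.
rewrite echar_expT dotC dot_suml (bigD1 i)//= dotZl dotC fweightE// eqxx mulr1.
rewrite big1 ?addr0 ?zetaX// => j /negPf ji.
by rewrite dotZl (dotC (coroot (sr j))) fweightE// eq_sym ji mulr0.
Qed.

Lemma torus_pt_inj : injective torus_pt.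
Proof.
move=> a b ab; apply/ffunP => i; apply/val_inj/eqP.
have := echar_fw_pt i a; rewrite ab echar_fw_pt => /esym/eqP.
by rewrite (eq_prim_root_expr zetaN_prim) !modn_small.
Qed.

Lemma torus_pt_surj u : (forall i, echar (fw i) u ^+ N = 1) ->
  exists a, torus_pt a = u.
Proof.
move=> uN; have /choice[a aE] i : exists a : 'I_N, echar (fw i) u = zetaN ^+ a.
  by have [a aE] := prim_rootP zetaN_prim (uN i); exists a.
exists (finfun a); apply: echar_fw_inj => i.
by rewrite echar_fw_pt ffunE aE.
Qed.

Lemma echar_ptX k a : echar k (torus_pt a) ^+ N = 1.
Proof.
have [c ->] := weight_sum k; rewrite echar_sum -prodrXl big1// => i _.
have fN n : echar (fw i *+ n) (torus_pt a) ^+ N = 1.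
  rewrite echarMn echar_fw_pt exprAC (exprAC zetaN).
  by rewrite (prim_expr_order zetaN_prim) !expr1n.
case: (intP (c i)) => [|n|n]; first by rewrite echar0l expr1n.
  exact: fN.
by rewrite mulrNz echarNl exprVn fN invr1.
Qed.

(** In these coordinates f is a function on (Z/N)^rank, and v is its inverse transform.
    Orthogonality factors into one geometric sum of N-th roots of unity per coordinate. *)
Lemma fourier_inversion (V : lmodType R[i]) (f : weight D -> V) :
  (forall k j, f (k + j *+ N) = f k) ->
  exists v : J -> V, forall k, f k = \sum_a echar (- k) (torus_pt a) *: v a.
Proof.
move=> fN; pose z := zetaN.
pose wt (m : J) := \sum_i fw i *+ m i : weight D.
have ept (m a : J) : echar (wt m) (torus_pt a) = \prod_i z ^+ (a i * m i).
  by rewrite echar_sum; apply: eq_bigr => i _; rewrite echarMn echar_fw_pt exprM.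
pose v a := \sum_m (N%:R ^- rank D * echar (wt m) (torus_pt a)) *: f (wt m).
have red k : exists m j, k = wt m + j *+ N.
  have [c ->] := weight_sum k; pose N0 := N%:Z.
  have N0p : (0 < N0)%R by [].
  have cN0 i : (0 <= (c i %% N0)%Z)%R by rewrite modz_ge0// gt_eqF.
  have cN i : (absz (c i %% N0)%Z < N)%N.
    by rewrite -ltz_nat gez0_abs// ltz_pmod.
  exists [ffun i => Ordinal (cN i)], (\sum_i fw i *~ (c i %/ N0)%Z).
  rewrite -sumrMnl -big_split/=; apply: eq_bigr => i _; rewrite ffunE/=.
  rewrite pmulrn gez0_abs//.
  by rewrite [RHS]addrC pmulrn -mulrzA -mulrzDr -divz_eq.
exists v => k; have [m [j ->]] := red k; rewrite fN.
have per a : echar (- (wt m + j *+ N)) (torus_pt a) = echar (- wt m) (torus_pt a).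
  rewrite !echarNl echarDl echarMn; congr (_^-1); rewrite -[RHS]mulr1; congr (_ * _).
  exact: echar_ptX.
under eq_bigr do rewrite per /v scaler_sumr.
rewrite exchange_big/=.
have orth m' : \sum_a echar (- wt m) (torus_pt a) *:
      ((N%:R ^- rank D * echar (wt m') (torus_pt a)) *: f (wt m')) =
    (m' == m)%:R *: f (wt m').
  under eq_bigr do rewrite scalerA mulrCA.
  rewrite -scaler_suml -mulr_sumr; congr (_ *: _).
  pose q i := z ^+ m' i / z ^+ m i.
  have q0 i : z ^+ m i != 0 by rewrite /z zetaX expi_neq0.
  transitivity (N%:R ^- rank D * \sum_(a : J) \prod_i q i ^+ a i).
    congr (_ * _); apply: eq_bigr => a _; rewrite echarNl !ept mulrC -prodf_div.
    apply: eq_bigr => i _.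
    by rewrite /q expr_div_n [(a i * m' i)%N]mulnC [(a i * m i)%N]mulnC !exprM.
  rewrite -(bigA_distr_bigA (fun i (b : 'I_N) => q i ^+ b)).
  have geo i : \sum_(b < N) q i ^+ b = (m' i == m i)%:R * N%:R.
    have [qE|qE] := eqVneq (m' i) (m i).
      rewrite /q qE mulfV// mul1r; under eq_bigr do rewrite expr1n.
      by rewrite sumr_const card_ord.
    have qN : q i ^+ N = 1.
      rewrite /q expr_div_n !(exprAC _ _ N).
      by rewrite (prim_expr_order zetaN_prim) !expr1n divr1.
    have q1 : q i - 1 != 0.
      rewrite subr_eq0; apply: contra_neq qE => q1; apply/val_inj/eqP.
      have : z ^+ m' i == z ^+ m i.
        by rewrite -[z ^+ m' i](divfK (q0 i)) -/(q i) q1 mul1r.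
      by rewrite (eq_prim_root_expr zetaN_prim) !modn_small.
    by apply: (mulfI q1); rewrite -subrX1 qN subrr mul0r mulr0.
  under eq_bigr do rewrite geo.
  rewrite big_split/= prodr_const card_ord mulrCA mulVf ?mulr1; last first.
    by rewrite expf_neq0// pnatr_eq0 -lt0n.
  have [->|] := eqVneq m' m; first by rewrite big1// => i _; rewrite eqxx.
  move=> /eqP/ffunP/existsNP[i /eqP/negPf mi].
  by rewrite (bigD1 i)//= mi mul0r.
under eq_bigr do rewrite orth.
rewrite (bigD1 m)//= eqxx scale1r big1 ?addr0// => m' /negPf ->.
by rewrite scale0r.
Qed.

End Points.

End Torus.

(** * Quantum root spaces *)

Section WeightMultiplicities.
Variables (R : realType) (D : lie_data R).

Local Notation tt := (Defs.tt D).

(** The second case is the default of [xget]; the support statements below hold in both. *)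
Lemma wmultP (k : tt) :
  (exists (V : vectType R[i]) (psi : kalg D -> 'End(V)),
     [/\ irreducible_rep psi, highest_weight psi k &
         wmult k = fun s => sdim (weight_space psi s)]) \/ wmult k = fun=> 0%N.
Proof.
rewrite /wmult; case: xgetP => [m _ [V [psi [h1 h2 ->]]]|_]; last by right.
by left; exists V, psi.
Qed.

Lemma sdim_weight_space (V : vectType R[i]) (psi : kalg D -> 'End(V)) (s : tt) :
  sdim (weight_space psi s) <> 0%N -> is_weight psi s.
Proof.
move=> d0; apply: contrapT => nw; apply: d0.
rewrite (_ : weight_space psi s = [set 0]) ?sdim_set0//.
apply/seteqP; split=> [v vs|_ -> H]; last by rewrite linear0 scaler0.
by apply: contrapT => v0; apply: nw; exists v.
Qed.

Lemma wmult_nonneg (k s : tt) : wmult k s <> 0%N -> nonneg (k - s).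
Proof.
by case: (wmultP k) => [[V [psi [_ [_ hk] ->]]] /sdim_weight_space/hk|->].
Qed.

Lemma weights_size (V : vectType R[i]) (psi : kalg D -> 'End(V)) (s : seq tt) :
  uniq s -> (forall x, x \in s -> is_weight psi x) -> (size s <= dim V)%N.
Proof.
move=> us sw.
have /choice[v vP] (j : 'I_(size s)) :
    exists v : V, v != 0 /\ weight_space psi s`_j v.
  by have [v /eqP v0 hv] := sw s`_j (mem_nth _ (ltn_ord j)); exists v.
have fv : free [tuple v j | j < size s].
  apply/freeP => a; under eq_bigr do rewrite nth_mktuple.
  move=> a0 j; have := @joint_eigenvectors_free _ _ tt (fun H => psi (vsval H)) _
    (fun (j : 'I_(size s)) H => 0 +i* dot s`_j H) (fun=> @linearP _ _ _ _ _)
    (fun j => a j *: v j).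
  move=> /(_ _ _ a0 j) H; have /eqP : a j *: v j = 0.
    apply: H => [H i|i i' ii' _ _].
      by rewrite linearZ/= (vP i).2 !scalerA mulrC.
    apply: contrapT => /forallNP sep; case/eqP: ii'; apply/val_inj/eqP.
    rewrite -(nth_uniq 0 (ltn_ord i) (ltn_ord i') us) -subr_eq0.
    apply/eqP/dot_nondeg => H; rewrite dotBl.
    by have /negP/negPn/eqP[->] := sep H; rewrite subrr.
  by rewrite scaler_eq0 (negPf (vP j).1) orbF => /eqP.
have := dimvS (subvf (span [tuple v j | j < size s])).
by rewrite (eqP fv) size_tuple dimvf.
Qed.

Lemma wmult_finite (k : tt) : finite_set [set s : weight D | wmult k (val s) <> 0%N].
Proof.
case: (wmultP k) => [[V [psi [_ _ ->]]]|->]; last first.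
  by rewrite (_ : [set _ | _] = set0)//; apply/seteqP; split.
apply: contrapT => /(infinite_set_fset (dim V).+1)[B BA].
apply/negP; rewrite -ltnNge ltnS.
rewrite -(size_map val (finmap.enum_fset B)); apply: (@weights_size _ psi).
  by rewrite map_inj_uniq ?finmap.fset_uniq//; exact: val_inj.
by move=> _ /mapP[x xB ->]; exact/sdim_weight_space/BA.
Qed.

End WeightMultiplicities.

Section Counting.
Variables (R : realType) (D : lie_data R).
Hypothesis hD : simple_lie_data D.
Variables (l : nat) (H : vectType R[i]) (Pi : (torus D -> R[i]) -> 'End(H)).

Local Notation tt := (Defs.tt D).
Local Notation weight := (Defs.weight D).
Local Notation in_Ra := [set k : weight | val k \in zspan (Rh D)].

Lemma clsWB : zmod_morphism (@clsW R D l).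
Proof. exact: (raddfB (\pi_(@Wl R D l)%qT)). Qed.

HB.instance Definition _ :=
  GRing.isZmodMorphism.Build weight (@Wl R D l) (@clsW R D l) clsWB.

Lemma clsW_eq0 (k : weight) : clsW l k = 0 <-> val k \in zspan (@ncRh R D l).
Proof.
have E : (k - 0 \in sublattice (@ncRh R D l)) = (val k \in zspan (@ncRh R D l)).
  by rewrite subr0.
rewrite -E Quotient.idealrBE; split=> [k0|/eqP k0].
  by apply/eqP; apply: etrans k0 _; rewrite -(raddf0 (\pi_(@Wl R D l)%qT)).
by apply: etrans k0 _; exact: (raddf0 (\pi_(@Wl R D l)%qT)).
Qed.

Lemma clsW_surj (g : @Wl R D l) : exists k, clsW l k = g.
Proof. by exists (repr g); exact: reprK. Qed.

Lemma Ra_weight x : x \in zspan (Rh D) -> x \in zspan (range (@fweight R D)).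
Proof.
move: x; apply: zspan_ind => [|x y|r /(Rh_root hD)]; [exact: rpred0|exact: rpredB|].
exact: root_weight.
Qed.

Lemma ncRh_Ra x : x \in zspan (@ncRh R D l) -> x \in zspan (Rh D).
Proof.
have [n _ nE] := nc_nat hD l; move: x.
apply: zspan_ind => [|x y|_ [r Rr <-]]; [exact: rpred0|exact: rpredB|].
by rewrite nE scaler_nat; apply: rpredMn; exact: zspan_gen.
Qed.

Lemma TA_Ra u : TA (Ra D) u <-> forall k : weight, in_Ra k -> echar k u = 1.
Proof. by apply: TAP => // x; exact: Ra_weight. Qed.

Lemma TA_root_lattice u : TA (root_lattice D) u <->
  forall k : weight, val k \in zspan (@is_root R D) -> echar k u = 1.
Proof.
apply: TAP => // x; move: x.
apply: zspan_ind => [|x y|r]; [exact: rpred0|exact: rpredB|].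
exact: root_weight.
Qed.

Lemma TlP u : Tl l u <->
  forall k : weight, val k \in zspan (@ncRh R D l) -> echar k u = 1.
Proof. by apply: TAP => // x /ncRh_Ra; exact: Ra_weight. Qed.

Definition wsupp (i : 'I_(rank D)) : seq weight :=
  finmap.enum_fset (fset_set [set s : weight | wmult (val (fw i)) (val s) <> 0%N]).

Lemma mem_wsupp i s : (s \in wsupp i) = (wmult (val (fw i)) (val s) != 0%N).
Proof.
rewrite /wsupp in_fset_set; last exact: wmult_finite.
by apply/idP/idP; rewrite inE => /eqP.
Qed.

Lemma wsupp_root i s : s \in wsupp i -> val (fw i - s) \in zspan (@is_root R D).
Proof.
rewrite mem_wsupp => /eqP/wmult_nonneg[c]; rewrite raddfB/= => ->.
apply: rpred_sum => j _; apply: rpredMn; apply: zspan_gen; exact: sroot_root.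
Qed.

Let mult i (s : weight) : R[i] := (wmult (val (fw i)) (val s))%:R.

Lemma fsum_wsupp (V : lmodType R[i]) i (f : weight -> V) :
  \sum_(s \in [set: weight]) mult i s *: f s = \sum_(s <- wsupp i) mult i s *: f s.
Proof.
rewrite -(@fsbig_widen _ _ _ _ [set s : weight | wmult (val (fw i)) (val s) <> 0%N])//.
  by rewrite fsbig_finite//; exact: wmult_finite.
by move=> s [_ /= /contrapT s0]; rewrite /mult s0 scale0r.
Qed.

Lemma chiE i u : chi (fw i) u = \sum_(s <- wsupp i) mult i s * echar s u.
Proof. exact: (@fsum_wsupp R[i]^o). Qed.

Lemma DeltaE i (f : @Wl R D l -> H) g :
  Delta (fw i) f g = \sum_(s <- wsupp i) mult i s *: f (g - clsW l s).
Proof. exact: fsum_wsupp. Qed.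

Lemma m_PiE u :
  m_Pi l Pi u = \dim (eigen_space (@echar R D) wsupp mult (@Piw R D l H Pi) u).
Proof.
rewrite /m_Pi -sdim_vspace; congr sdim; apply/seteqP; split=> v /= hv.
  by apply/eigen_spaceP => i; rewrite hv chiE.
by move=> i; rewrite chiE; move/eigen_spaceP: hv => ->.
Qed.

Lemma expi_dotN (j : weight) u : expi (- dot (val j) (logT u)) = echar (- j) u.
Proof. by rewrite /echar raddfN dotNl. Qed.

Lemma translation_Rh_Ra (f : @Wl R D l -> H) u :
  (forall j : weight, Rh D (val j) ->
     translation j f = expi (- dot (val j) (logT u)) *: f) <->
  (forall j : weight, Ra D (val j) ->
     translation j f = expi (- dot (val j) (logT u)) *: f).
Proof.
split=> h j Rj; last by apply: h; exact: zspan_gen.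
pose P x := forall j : weight, val j = x ->
  forall g, f (g + clsW l j) = echar (- j) u *: f g.
(* The induction on the span runs in [tt], while translations take weights, so membership in the
   weight lattice is carried along. *)
suff hP x : x \in zspan (Rh D) -> x \in zspan (range (@fweight R D)) /\ P x.
  by apply/funext => g; have [_ Pj] := hP _ Rj; rewrite expi_dotN; exact: Pj.
move: x {j Rj}; apply: zspan_ind => [|x y [xW Px] [yW Py]|r Rr].
- split=> [|j j0 g]; first exact: rpred0.
  have -> : j = 0 by apply: val_inj; rewrite j0 raddf0.
  by rewrite raddf0 addr0 oppr0 echar0l scale1r.
- split=> [|j jE g]; first exact: rpredB.
  pose x' : weight := exist _ x xW; pose y' : weight := exist _ y yW.
  have -> : j = x' - y' by apply: val_inj; rewrite jE raddfB.
  have := Py y' erefl (g + clsW l x' - clsW l y'); rewrite subrK (Px x' erefl g) => e1.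
  rewrite raddfB/= addrA opprB echarDl -scalerA [_ *: f g]e1.
  by rewrite scalerA -echarDl subrr echar0l scale1r.
- split=> [|j jE g]; first by apply: root_weight => //; exact: Rh_root.
  have := h j; rewrite jE => /(_ Rr) hj.
  by rewrite -[LHS]/(translation j f g) hj -jE expi_dotN.
Qed.

(** The abstract count over N-torsion points. As N W lies in n_c R_a, in R_a and in M, the points of
    u + T_{R_a} are N-torsion and so are all translates by [Mperp]. *)
Lemma spectral_count (M : set weight) (A : weight -> 'End(H)) (X : set (torus D)) u :
  let Mperp := [set c : torus D | forall j, M j -> echar j c = 1] in
  Tl l u -> M 0 -> (forall j k, M j -> M k -> M (j - k)) -> in_Ra `<=` M ->
  X `<=` TA (Ra D) ->
  (forall c, TA (Ra D) c -> exists2 x, X x & Mperp (c - x)) ->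
  (forall x y, X x -> X y -> Mperp (x - y) -> x = y) ->
  (forall k j, M j -> A (k + j) = A k) ->
  (forall k v, A k (A k v) = A k v) ->
  (forall k k' v, ~ M (k - k') -> A k (A k' v) = 0) ->
  (forall v, (forall k, A k v = 0) -> v = 0) ->
  (forall i s, s \in wsupp i -> M (fw i - s)) ->
  (forall i k v, Piw l Pi i (A k v) = A (k - fw i) (Piw l Pi i v)) ->
  sdim [set f : @Wl R D l -> H | [/\ root_space Pi f,
      forall k, A k (f (clsW l k)) = f (clsW l k) &
      forall j : weight, Ra D (val j) ->
        translation j f = expi (- dot (val j) (logT u)) *: f]] =
  (\sum_(v \in X) m_Pi l Pi (u + v))%N.
Proof.
move=> Mperp /TlP Tu M0 MB NM XT X_rep X_uniq AM AA A_orth A_faithful ssM PiA.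
have [N N_gt0 NP] := ncRh_full hD l.
have NW (k : weight) : val (k *+ N) \in zspan (@ncRh R D l).
  by rewrite raddfMn; apply: NP; exact: valP.
have nondeg (x : torus D) : (forall k, echar k x = 1) -> x = 0.
  by move=> x1; apply: (@echar_fw_inj R D hD x 0) => i; rewrite x1 echar0r.
have fourier (f : @Wl R D l -> H) : exists v : {ffun 'I_(rank D) -> 'I_N} -> H,
    forall k, f (clsW l k) = \sum_a echar (- k) (torus_pt a) *: v a.
  apply: (fourier_inversion hD N_gt0 (f := fun k => f (clsW l k))) => k j.
  by rewrite raddfD/= (_ : clsW l (j *+ N) = 0) ?addr0//; apply/clsW_eq0.
have NRa k : in_Ra (k *+ N) by exact/ncRh_Ra.
have NX c i : (forall j : weight, in_Ra j -> echar j c = 1) -> echar (fw i) c ^+ N = 1.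
  by move=> c1; rewrite -echarMn c1.
have ptT c : (forall j : weight, in_Ra j -> echar j c = 1) ->
    exists a : {ffun 'I_(rank D) -> 'I_N}, torus_pt a = u + c.
  move=> c1; apply: torus_pt_surj => // i.
  by rewrite echarDr// exprMn (NX c i c1) mulr1 -echarMn Tu.
have pt_shift (a : {ffun 'I_(rank D) -> 'I_N}) c : Mperp c ->
    exists b : {ffun 'I_(rank D) -> 'I_N}, torus_pt b = torus_pt a + c.
  move=> c1; apply: torus_pt_surj => // i.
  by rewrite echarDr// exprMn echar_ptX// mul1r (NX c i)// => j /NM; exact: c1.
have kerN k : clsW l k = 0 -> in_Ra k by move=> /clsW_eq0/ncRh_Ra.
have ker_u k : clsW l k = 0 -> echar k u = 1 by move=> /clsW_eq0/Tu.
have XT' : X `<=` [set c | forall j : weight, in_Ra j -> echar j c = 1].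
  by move=> x /XT/TA_Ra.
have X_rep' c : (forall j : weight, in_Ra j -> echar j c = 1) ->
    exists2 x, X x & Mperp (c - x).
  by move=> /TA_Ra/X_rep.
have count := @sdim_spectral_set _ weight (torus D) (@Wl R D l) H 'I_(rank D) _
  (@echar R D) (@clsW R D l) (@torus_pt R D N) M in_Ra X u A
  (@fw R D) wsupp mult (Piw l Pi)
  (@echarDl R D) (echarDr hD) (@echar0l R D) (echar0r hD) nondeg
  clsW_surj (torus_pt_inj hD N_gt0) fourier M0 MB NM ptT pt_shift kerN ker_u
  XT' X_rep' X_uniq AM AA A_orth A_faithful ssM PiA.
transitivity (sdim (spectral_set (@echar R D) (@clsW R D l) in_Ra u A wsupp
    mult (Piw l Pi))).
  congr sdim; apply/seteqP; split=> f [f1 f2 f3]; split=> //.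
  - by move=> i g; rewrite -DeltaE f1.
  - by move=> j Nj g; rewrite -expi_dotN -[LHS]/(translation j f g) f3.
  - by move=> i; apply/funext => g; rewrite DeltaE f1.
  - by move=> j Nj; apply/funext => g; rewrite expi_dotN; exact: f3.
rewrite count; pose B := [set a : {ffun 'I_(rank D) -> 'I_N} | X (torus_pt a - u)].
have bij : set_bij B X (fun a => torus_pt a - u).
  split=> [a//|a b _ _ /addIr/(torus_pt_inj hD N_gt0)//|x Xx].
  have [a aE] := ptT x (XT' _ Xx); have ax : torus_pt a - u = x.
    by rewrite aE addrC addKr.
  by exists a; rewrite /B/= ax.
rewrite [RHS](@reindex_fsbig _ _ _ _ _ _ _ _ _ bij).
under [RHS]eq_fsbigr do rewrite addrC subrK m_PiE.
rewrite [LHS]bigfs ?index_enum_uniq//; last by move=> a _; rewrite mem_index_enum.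
by apply: eq_fsbigl; apply/seteqP; split=> a /= /asboolP.
Qed.

End Counting.

(** * Homogeneous components *)

Section Grading.
Variables (R : realType) (D : lie_data R) (H : vectType R[i]).
Variable gr : Zg D -> {vspace H}.
Hypothesis gr_grading : is_grading gr.

Local Notation Zg := (Defs.Zg D).
Implicit Types (v : H) (z : Zg).

Definition is_decomp v (c : Zg -> H) : Prop :=
  [/\ finite_set [set z | c z <> 0], forall z, c z \in gr z &
      v = \sum_(z \in [set: Zg]) c z].

Definition hcomp z v : H := projT1 (cid (gr_grading v)) z.

Lemma hcompP v : is_decomp v (hcomp^~ v).
Proof. by rewrite /hcomp; case: cid => c []. Qed.

Lemma hcomp_uniq v c : is_decomp v c -> forall z, hcomp z v = c z.
Proof. by move=> vc z; rewrite /hcomp; case: cid => c' /= [_ /(_ c vc) ->]. Qed.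

Lemma fsum_support (c : Zg -> H) (B : set Zg) : finite_set B ->
  [set z | c z <> 0] `<=` B ->
  \sum_(z \in [set: Zg]) c z = \sum_(z <- finmap.enum_fset (fset_set B)) c z.
Proof.
move=> fB cB; rewrite -fsbig_finite//; symmetry; apply: fsbig_widen => // z [_ nB].
by apply: contrapT => cz; apply: nB; exact: cB.
Qed.

(** By uniqueness of decompositions; the union of both supports is a common finite range for the
    sums. *)
Lemma hcomp_linear z : linear (hcomp z).
Proof.
move=> a x y; have [fx gx xE] := hcompP x; have [fy gy yE] := hcompP y.
apply: (@hcomp_uniq _ (fun z => a *: hcomp z x + hcomp z y)).
pose B := [set z | hcomp z x <> 0] `|` [set z | hcomp z y <> 0].
have fB : finite_set B by rewrite finite_setU.
have sB : [set z | a *: hcomp z x + hcomp z y <> 0] `<=` B.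
  move=> t /= t0; apply: contrapT => /not_orP[/contrapT x0 /contrapT y0].
  by apply: t0; rewrite x0 y0 scaler0 addr0.
split; first exact: sub_finite_set sB fB.
  by move=> t; rewrite rpredD ?rpredZ.
rewrite (fsum_support fB sB) big_split/= -scaler_sumr.
rewrite -(fsum_support (c := hcomp^~ x) fB); last exact: subsetUl.
by rewrite -(fsum_support (c := hcomp^~ y) fB) -?xE -?yE//; exact: subsetUr.
Qed.

Lemma hcomp_gr z v t : v \in gr z -> hcomp t v = if t == z then v else 0.
Proof.
move=> vz; apply: (@hcomp_uniq _ (fun t => if t == z then v else 0)).
have s1 : [set t | (if t == z then v else 0) <> 0] `<=` [set z].
  by move=> x /=; case: eqP.
split; first exact: sub_finite_set s1 (finite_set1 z).
  by move=> x; case: eqP => [->//|_]; exact: rpred0.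
rewrite -(@fsbig_widen _ _ _ _ [set z])//; first by rewrite fsbig_set1 eqxx.
by move=> x [_ /= /eqP/negPf ->].
Qed.

Lemma hcomp_in z v : hcomp z v \in gr z.
Proof. by case: (hcompP v). Qed.

Lemma hcomp_faithful v : (forall z, hcomp z v = 0) -> v = 0.
Proof. by move=> v0; have [_ _ ->] := hcompP v; exact: fsbig1. Qed.

(** The images of the components of v, reindexed by d, decompose T v. *)
Lemma hcomp_shift (T : 'End(H)) d : (forall z, (T @: gr z <= gr (z + d))%VS) ->
  forall z v, T (hcomp z v) = hcomp (z + d) (T v).
Proof.
move=> Tgr z v; have [fv gv vE] := hcompP v.
pose c t := T (hcomp (t - d) v).
rewrite (@hcomp_uniq (T v) c) /c ?addrK//.
have sc : [set t | T (hcomp (t - d) v) <> 0] `<=`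
    [set t + d | t in [set t | hcomp t v <> 0]].
  move=> t /= ct; exists (t - d); last by rewrite subrK.
  by move=> h0; apply: ct; rewrite h0 linear0.
have fc : finite_set [set t + d | t in [set t | hcomp t v <> 0]] by exact: finite_image.
split; first exact: sub_finite_set sc fc.
  move=> t; rewrite -{2}(subrK d t).
  by apply: (subvP (Tgr _)); apply: memv_img; exact: hcomp_in.
rewrite -(@reindex_fsbigT _ _ _ _ _ (fun t => t - d)
  (fun t => T (hcomp t v))); last first.
  by exists (fun t => t + d) => t; rewrite ?subrK ?addrK.
have sT : [set t | T (hcomp t v) <> 0] `<=` [set t | hcomp t v <> 0].
  by move=> t /= ct h0; apply: ct; rewrite h0 linear0.
by rewrite (fsum_support fv sT) {1}vE (fsum_support fv)// raddf_sum.
Qed.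

Definition hproj z : 'End(H) := linfun (hcomp z).

Lemma hprojE z v : hproj z v = hcomp z v.
Proof.
pose fL : {linear H -> H} :=
  HB.pack (hcomp z) (GRing.isLinear.Build _ _ _ _ _ (hcomp_linear z)).
exact: (lfunE fL).
Qed.

End Grading.

Lemma clsZB (R : realType) (D : lie_data R) : zmod_morphism (@clsZ R D).
Proof. exact: (raddfB (\pi_(@Zg R D)%qT)). Qed.

HB.instance Definition _ (R : realType) (D : lie_data R) :=
  GRing.isZmodMorphism.Build (weight D) (Zg D) (@clsZ R D) (@clsZB R D).

Lemma clsZ_eq0 (R : realType) (D : lie_data R) (k : weight D) :
  clsZ k = 0 <-> val k \in zspan (@is_root R D).
Proof.
have E : (k - 0 \in sublattice (@is_root R D)) = (val k \in zspan (@is_root R D)).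
  by rewrite subr0.
rewrite -E Quotient.idealrBE; split=> [k0|/eqP k0].
  by apply/eqP; apply: etrans k0 _; rewrite -(raddf0 (\pi_(Zg D)%qT)).
by apply: etrans k0 _; exact: (raddf0 (\pi_(Zg D)%qT)).
Qed.

(** * The ungraded and graded formulas *)

Section Multiplicities.
Variables (R : realType) (D : lie_data R).
Hypothesis hD : simple_lie_data D.
Variables (l : nat) (H : vectType R[i]) (ip : {dot H for Num.conj}).
Variable Pi : (torus D -> R[i]) -> 'End(H).

Local Notation weight := (Defs.weight D).

Lemma translation_mult_Rh (S : set (@Wl R D l -> H)) u :
  translation_mult S (Rh D) u = translation_mult S (Ra D) u.
Proof.
congr sdim; apply/seteqP; split=> f [Sf hf]; split=> //.
  exact/(translation_Rh_Ra hD).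
exact/(translation_Rh_Ra hD).
Qed.

Lemma m_A_Ra u : Tl l u ->
  m_A l Pi (Ra D) u = (\sum_(v \in TA (Ra D)) m_Pi l Pi (u + v))%N.
Proof.
(* Characters separate the points of the torus, so the annihilator of the whole weight lattice is
   trivial and T_{R_a} represents itself. *)
move=> Tu; rewrite -(spectral_count hD (M := setT) (A := fun=> \1%VF) (u := u))//.
- congr sdim; apply/seteqP; split=> f.
    by move=> [f1 f2]; split=> // k; rewrite id_lfunE.
  by move=> [f1 _ f2].
- by move=> c Tc; exists c => // j _; rewrite subrr echar0r.
- move=> x y _ _ xy; apply/eqP; rewrite -subr_eq0; apply/eqP.
  by apply: (@echar_fw_inj R D hD _ 0) => i; rewrite xy// echar0r.
- by move=> k v; rewrite !id_lfunE.
- by move=> k k' v /(_ I).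
- by move=> v /(_ 0); rewrite id_lfunE.
- by move=> i k v; rewrite !id_lfunE.
Qed.

Variable gr : Zg D -> {vspace H}.
Hypothesis hG : GUS_rep l ip Pi gr.

Lemma m_A0_Ra X u : Tl l u -> coset_reps (TA (Ra D)) (TA (root_lattice D)) X ->
  m_A0 l Pi gr (Ra D) u = (\sum_(v \in X) m_Pi l Pi (u + v))%N.
Proof.
move=> Tu [XT Xr]; have hgr := GUS_grading hG.
pose M := [set k : weight | val k \in zspan (@is_root R D)].
pose A (k : weight) := hproj hgr (clsZ (- k)).
have MB j k : M j -> M k -> M (j - k).
  by move=> Mj Mk; have := rpredB Mj Mk; rewrite -raddfB.
have perp c : (forall j, M j -> echar j c = 1) <-> TA (root_lattice D) c.
  by split=> h; exact/(TA_root_lattice hD).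
rewrite -(spectral_count hD (M := M) (A := A) (u := u))//.
- congr sdim; apply/seteqP; split=> f.
    move=> [[f1 f2] f3]; split=> // k.
    by rewrite hprojE (hcomp_gr hgr _ (f2 k)) eqxx.
  move=> [f1 f2 f3]; split=> //; split=> // k.
  by rewrite -f2 hprojE hcomp_in.
- exact: (rpred0 (zspan (@is_root R D))).
- move=> k; rewrite /M/=; move: (\val k).
  apply: zspan_ind => [|x y|r /(Rh_root hD)]; [exact: rpred0|exact: rpredB|].
  exact: zspan_gen.
- by move=> c /Xr[x [[Xx cx] _]]; exists x => //; exact/perp.
- move=> x y Xx Xy /perp xy; have [x' [_ x'P]] := Xr x (XT _ Xx).
  rewrite -(x'P y)// -(x'P x)//; split=> //; apply/perp => j _.
  by rewrite subrr echar0r.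
- move=> k j Mj; have j0 : clsZ j = 0 by apply/clsZ_eq0.
  by rewrite /A opprD raddfB/= j0 subr0.
- by move=> k v; rewrite !hprojE (hcomp_gr _ _ (hcomp_in _ _ _)) eqxx.
- move=> k k' v nM; rewrite !hprojE (hcomp_gr _ _ (hcomp_in _ _ _)).
  case: eqP => // kk; case: nM; apply/clsZ_eq0.
  by move: kk; rewrite !raddfN => /oppr_inj kk; rewrite raddfB/= kk subrr.
- move=> v v0; apply: (hcomp_faithful (gr_grading := hgr)) => z.
  by have := v0 (- repr z); rewrite hprojE opprK /clsZ reprK.
- by move=> i s; exact: wsupp_root.
(* The operator of w is that of w + rho, and rho cancels in the shift of degrees; so degree -k goes
   to -(k - w). *)
- move=> i k v; rewrite !hprojE (hcomp_shift hgr (d := clsZ (fw i))).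
    by rewrite -raddfD/= opprB addrC.
  by move=> z; have := GUS_shift hG (fw i + rho D) z; rewrite addrK.
Qed.

End Multiplicities.

Theorem theorem8p28 (R : realType) (D : lie_data R) (hD : simple_lie_data D)
  (l : nat) (H : vectType R[i]) (ip : {dot H for Num.conj})
  (Pi : (torus D -> R[i]) -> 'End(H)) (hPi : US_rep l ip Pi) :
  [/\ (forall u, Tl0 l u ->
         m_Phi l Pi u = m_A l Pi (Ra D) u /\
         m_A l Pi (Ra D) u = \sum_(v \in TA (Ra D)) m_Pi l Pi (u + v)),
      (forall gr : Zg D -> {vspace H}, GUS_rep l ip Pi gr ->
         forall u, Tl0 l u ->
         m_Phi0 l Pi gr u = m_A0 l Pi gr (Ra D) u /\
         (forall X, coset_reps (TA (Ra D)) (TA (root_lattice D)) X ->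
            m_A0 l Pi gr (Ra D) u = \sum_(v \in X) m_Pi l Pi (u + v))) &
      (type_ADE D ->
         TA (root_lattice D) = TA (Ra D) /\
         forall gr : Zg D -> {vspace H}, GUS_rep l ip Pi gr ->
         forall u, Tl0 l u -> m_Phi0 l Pi gr u = m_Pi l Pi u)].
Proof.
split=> [u [Tu _]|gr hG u [Tu _]|ade].
- by split; [exact: translation_mult_Rh|exact: (m_A_Ra hD Pi Tu)].
- by split=> [|X XP]; [exact: translation_mult_Rh|exact: (m_A0_Ra hD hG Tu XP)].
have ET : TA (root_lattice D) = TA (Ra D).
  congr TA; apply/seteqP; split=> x; apply: zspan_ind.
  - exact: rpred0.
  - by move=> *; exact: rpredB.
  - by move=> r; exact: type_ADE_root_lattice.
  - exact: rpred0.
  - by move=> *; exact: rpredB.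
  - by move=> r /(Rh_root hD); exact: zspan_gen.
split=> // gr hG u [Tu _].
(* Both groups coincide, so the trivial element alone represents the quotient. *)
have X0 : coset_reps (TA (Ra D)) (TA (root_lattice D)) [set 0].
  rewrite ET; split=> [_ ->|a Ta]; first by apply/TA_Ra => // k _; exact: echar0r.
  by exists 0; split=> [|_ [-> _]//]; rewrite subr0.
transitivity (m_A0 l Pi gr (Ra D) u); first exact: translation_mult_Rh.
by rewrite (m_A0_Ra hD hG Tu X0) fsbig_set1 addr0.
Qed.
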